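(* The only cubic, cycle-conformal brace is, up to isomorphism, the complete bipartite graph $K_{3,3}$. That is, $K_{3,3}$ is a cubic, cycle-conformal brace, and every cubic, cycle-conformal brace is isomorphic to $K_{3,3}$.
   Context: Graphs are finite, without loops or multiple edges. Cubic means $3$-regular. A brace is a $2$-connected, bipartite graph in which any matching of size at most two can be extended to a perfect matching of the graph. A cycle $C \subseteq G$ is conformal if $G - V(C)$ has a perfect matching (the empty graph counts as having a perfect matching). A graph is cycle-conformal if it has a perfect matching and all of its even cycles are conformal. *)

(* Defs.v *)
From mathcomp Require Import all_boot.

Set Implicit Arguments.
Unset Strict Implicit.
Unset Printing Implicit Defensive.

Record sgraph := SGraph {
  vertex :> finType;
  adj : rel vertex;
  adj_sym : symmetric adj;
  adj_irr : irreflexive adj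
}.

Definition isomorphic (G H : sgraph) : Prop :=
  exists2 f : G -> H, bijective f & forall x y : G, adj (f x) (f y) = adj x y.

Section Notions.
Variable G : sgraph.
Implicit Types (A X : {set G}) (M N : {set {set G}}) (c : seq G).

(* Below, A stands for the induced subgraph G[A]; thus [set: G] stands for G
   itself and ~: X for G - X. *)

Definition edges A : {set {set G}} :=
  [set [set x; y] | x in A, y in A & adj x y].

Definition matching A M : Prop := M \subset edges A /\ trivIset M.

Definition perfect_matching A M : Prop := matching A M /\ cover M = A.

Definition has_perfect_matching A : Prop := exists M, perfect_matching A M.

Definition connected A : Prop :=
  A != set0 /\
  {in A &, forall x y, connect [rel u v | [&& u \in A, v \in A & adj u v]] x y}.

Definition two_connected : Prop :=
  2 < #|G| /\ forall X, #|X| < 2 -> connected (~: X).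

Definition bipartite : Prop :=
  exists f : G -> bool, forall x y, adj x y -> f x != f y.

Definition cubic : Prop := forall x : G, #|[set y | adj x y]| = 3.

Definition brace : Prop :=
  [/\ two_connected, bipartite &
      forall M, matching [set: G] M -> #|M| <= 2 ->
        exists2 N, perfect_matching [set: G] N & M \subset N].

(* A cycle of G is listed as the sequence of its vertices in cyclic order.
   The bound on the size is needed because ucycle also accepts the empty
   sequence and x, y for an edge xy. *)
Definition is_cycle c : Prop := 2 < size c /\ ucycle (@adj G) c.

Definition conformal c : Prop := has_perfect_matching (~: [set x in c]).

Definition cycle_conformal : Prop :=
  has_perfect_matching [set: G] /\
  forall c, is_cycle c -> ~~ odd (size c) -> conformal c.

End Notions.

Section CompleteBipartite.
Variables m n : nat.

Definition Kadj : rel ('I_m + 'I_n) :=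
  fun u v => match u, v with
             | inl _, inr _ | inr _, inl _ => true
             | _, _ => false
             end.

Lemma Kadj_sym : symmetric Kadj. Proof. by case=> ? []. Qed.

Lemma Kadj_irr : irreflexive Kadj. Proof. by case. Qed.

Definition complete_bipartite : sgraph := SGraph Kadj_sym Kadj_irr.

End CompleteBipartite.

(* Main.v *)
Require Import Defs.
From mathcomp Require Import all_boot zify.

Set Implicit Arguments.
Unset Strict Implicit.
Unset Printing Implicit Defensive.

(** In [K_{3,3}] a set of vertices has a perfect matching as soon as it meets
    both colour classes equally often.  The complement of a cycle and the
    complement of the vertices covered by a matching have that property, so
    [K_{3,3}] is a cycle-conformal brace.

    For the converse, let [v] be a vertex of a cubic cycle-conformal brace [G]
    and let [a], [b], [c] be its neighbours.  A cycle through [a], [b] and [c] that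
    avoids [v] would leave [v] isolated, so it would not be conformal
    ([conformal_isolated]).  Hence no such cycle exists, and it is shown that
    this alone makes the brace a [K_{3,3}].

    The brace property enters through edge cuts: counting edges and matching
    edges across a cut shows that a cut with at least two vertices on each side
    has at least four edges ([brace_cut]).  In particular removing two vertices
    leaves a connected graph, so by Menger's theorem ([two_paths]) there is a
    cycle [C] through [b] and [c] in [G - v].  Call its two arcs from [b] to [c]
    [p] and [q].  Two disjoint paths from [a] to [C] exist since otherwise an
    edge cut would be too small; if both end in [p], or both in [q], they
    reroute [C] through [a].  So one ends at [u] in [p] and the other at [w] in
    [q]: there is a theta graph with branch vertices [u] and [w] whose three
    arcs contain [a], [b] and [c] respectively ([theta_exists]).

    Cut the arcs of the theta graph at [a], [b] and [c] to get a claw at [u]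
    and a claw at [w].  Suppose that a path outside [v], [a], [b], [c] links the
    two claws.  If its ends lie on different arcs, following the theta graph and
    the path gives a cycle through [a], [b] and [c].  If they lie on the same
    arc, say that of [a], then path and arc contain a cycle [O] through [a] that
    is disjoint from [v] and from the cycle [C] formed by the other two arcs.
    That is impossible too ([ring_off_cycle_false]): since no two disjoint paths
    lead from [a] to [p], a set [X1] containing [a] is joined by at most one
    edge to the rest of [G - v - b - c - q]; likewise [X2] for [q].  Both sets
    contain [O], and the intersection [X1 :&: X2] has at most three edges
    leaving it, against [brace_cut].

    So [v], [a], [b], [c] separate [u] from [w] ([theta_separates]).  Only six
    edges leave [a], [b], [c] apart from those to [v], and each side of the
    separation needs at least three of them, so each side is a single vertex by
    [brace_cut] ([theta_sides]), adjacent to [a], [b] and [c]. *)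

(** * Sequences *)

(** Multiplicities turn the uniqueness of concatenations and reversals of
    sequences into linear arithmetic; this is how all disjointness conditions
    on paths are discharged below. *)
Lemma uniq_countP (T : eqType) (s : seq T) :
  reflect (forall z, count_mem z s <= 1) (uniq s).
Proof.
apply: (iffP idP) => [us z | ]; first by rewrite count_uniq_mem // leq_b1.
elim: s => //= x s IHs le1; apply/andP; split.
  by have:= le1 x; rewrite eqxx -has_pred1 has_count; lia.
by apply: IHs => z; have:= le1 z; lia.
Qed.

Lemma notin_count (T : eqType) (s t : seq T) :
  {in s, forall z, z \notin t} ->
  forall z, count_mem z s = 0 \/ count_mem z t = 0.
Proof.
move=> dis z; case: (boolP (z \in s)) => [/dis|] /count_memPn; tauto.
Qed.

Lemma split_first (T : eqType) (P : pred T) s : has P s ->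
  exists s1 x s2, [/\ s = s1 ++ x :: s2, P x & {in s1, forall z, ~~ P z}].
Proof.
elim: s => //= x s IHs; case: (boolP (P x)) => [Px _|nPx /= /IHs].
  by exists [::], x, s.
case=> s1 [y [s2 [-> Py nP]]]; exists (x :: s1), y, s2; split=> // z.
by rewrite inE => /predU1P[->|/nP].
Qed.

Lemma split_last (T : eqType) (P : pred T) s : has P s ->
  exists s1 x s2, [/\ s = s1 ++ x :: s2, P x & {in s2, forall z, ~~ P z}].
Proof.
rewrite -has_rev => /split_first[s1 [x [s2 [eqs Px nP]]]].
exists (rev s2), x, (rev s1); split=> // [|z]; last by rewrite mem_rev => /nP.
by rewrite -(revK s) eqs rev_cat rev_cons cat_rcons.
Qed.

Lemma mem_split (T : eqType) (x : T) s : x \in s -> exists s1 s2, s = s1 ++ x :: s2.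
Proof. by case/path.splitPr => s1 s2; exists s1, s2. Qed.

(** * Menger's theorem for two paths *)

Section Menger.
Variables (T : finType) (e : rel T) (a t : T).

(** The target [t] stays reachable even for [z = t], so that asking for a
    connection avoiding each [z] includes asking for a connection at all. *)
Definition avoiding (z : T) : rel T := [rel x y | e x y && ((y == t) || (y != z))].

(** If no single vertex separates [a] from [t], there are two internally
    disjoint paths from [a] to [t]; both may be the single edge from [a] to [t].
    The proof keeps two internally disjoint paths [p], [q] from [a] to a vertex
    [y] and a path [s] from [y] to [t] that meets them only in [y], and shortens
    [s]: a path [r] from [a] to [t] that avoids [y] leaves [p] and [q] for the
    last time at some [o] and then reaches [s] at some [y'] for the first time.
    Switching to [r] between [o] and [y'], and keeping the other path extended
    along [s], yields two disjoint paths to [y']. *)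
Lemma two_paths : a != t ->
    (forall z, z != a -> connect (avoiding z) a t) ->
  exists p q, [/\ path e a (rcons p t), path e a (rcons q t)
                & uniq (a :: t :: p ++ q)].
Proof.
move=> neq_at conn; have neq_ta: t != a by rewrite eq_sym.
have sub z : subrel (avoiding z) e by move=> x y /andP[].
(* Initially [y] is the first vertex of a path from [a] to [t], and both
   paths to [y] are the same edge. *)
have [y [p [q [s [py qy ys ts us]]]]] : exists y p q s,
    [/\ path e a (rcons p y), path e a (rcons q y), path e y s, last y s = t
      & uniq (a :: p ++ q ++ y :: s)].
  have /connectP[s0 /shortenP[s s_p us _] t_s] := conn t neq_ta.
  case: s => [|y s] in s_p us t_s; first by rewrite t_s eqxx in neq_at.
  exists y, [::], [::], s; have /= /andP[eay ys] := sub_path (sub t) s_p.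
  by split; rewrite //= eay.
have [n] := ubnP (size s); elim: n y p q s py qy ys ts us => // n IHn.
move=> y p q s py qy ys ts us; case: (eqVneq y t) => [yt|neq_yt] /ltnSE-le_sn.
  exists p, q; rewrite -yt; split=> //; apply/uniq_countP => z.
  by move/uniq_countP/(_ z): us; rewrite /= !count_cat /=; clear; lia.
have ya: y != a.
  by apply: contraTneq us => ->; rewrite /= !mem_cat inE eqxx !orbT.
have /connectP[r0 /shortenP[r r_p ur _] t_r] := conn y ya.
have [r' [o [r1 [eq_r Oo nO]]]]:
    exists r' o r1, [/\ a :: r = r' ++ o :: r1, o \in a :: p ++ q
      & {in r1, forall z, z \notin a :: p ++ q}].
  apply: (@split_last _ (mem (a :: p ++ q))); apply/hasP; exists a; exact: mem_head.
have path_r1: path (avoiding y) o r1.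
  case: r' eq_r => [|a' r'] [a_o eq_r]; first by rewrite -a_o -eq_r.
  by move: r_p; rewrite eq_r cat_path /= => /and3P[].
have last_r1: last o r1 = t.
  by have:= congr1 (last a) eq_r; rewrite /= last_cat /= -t_r.
have t_in_s: t \in s.
  by case: s ts {ys us le_sn} => [/eqP|x s /= <-]; rewrite ?(negPf neq_yt) // mem_last.
have t_notin: t \notin a :: p ++ q.
  have: uniq ((a :: p ++ q) ++ y :: s) by rewrite /= -catA.
  by rewrite cat_uniq => /and3P[_ /hasPn/(_ t)-> //]; rewrite inE t_in_s orbT.
have t_r1 : t \in r1.
  case: (r1) last_r1 => [/= o_t|x r2 /= <-]; last exact: mem_last.
  by rewrite -o_t Oo in t_notin.
have [r2 [y' [r3 [eq_r1 sy' ns]]]]: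
    exists r2 y' r3, [/\ r1 = r2 ++ y' :: r3, y' \in s & {in r2, forall z, z \notin s}].
  by apply: (@split_first _ (mem s)); apply/hasP; exists t.
have [s1 [s2 eq_s]] := mem_split sy'.
have o_r2: path e o (rcons r2 y').
  move: path_r1; rewrite eq_r1 -cat_rcons cat_path => /andP[+ _]; exact/sub_path/sub.
have y_r2: y \notin r2.
  apply/negP => yr2; have: y \in r1 by rewrite eq_r1 mem_cat yr2.
  elim: (r1) (o) path_r1 => //= x r1' IH o' /andP[/andP[_ xy] /IH{}IH].
  by rewrite inE => /predU1P[yx|//]; rewrite -yx eqxx (negPf neq_yt) in xy.
have ys1: path e y (rcons s1 y').
  by move: ys; rewrite eq_s -cat_rcons cat_path => /andP[].
have y's2: path e y' s2.
  by move: ys; rewrite eq_s cat_path => /and3P[].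
have ts2: last y' s2 = t by rewrite -ts eq_s last_cat.
have ltsn: size s2 < n by apply: leq_trans le_sn; rewrite eq_s size_cat /= addnS ltnS leq_addl.
have ext c : path e a (rcons c y) -> path e a (rcons (c ++ y :: s1) y').
  by rewrite rcons_cat rcons_cons -cat_rcons cat_path last_rcons => ->.
have nO2: {in r2, forall z, z \notin a :: p ++ q}.
  by move=> z z2; apply: nO; rewrite eq_r1 mem_cat z2.
have ur2: uniq r2.
  by move: ur; rewrite eq_r eq_r1 cat_uniq /= cat_uniq => /and3P[_ _ /andP[_ /and3P[]]].
have cts z : [/\ count_mem z (a :: p ++ q ++ y :: s) <= 1,
   count_mem z r2 <= 1, count_mem z r2 = 0 \/ (a == z) + count_mem z p + count_mem z q = 0,
   count_mem z r2 = 0 \/ (y == z) = 0 :> nat & count_mem z r2 = 0 \/ count_mem z s = 0].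
  split; try exact: (uniq_countP _ _).
  - by have /= := notin_count nO2 z; rewrite count_cat addnA.
  - by case: eqVneq => [<-|]; [left; apply/count_memPn | right].
  exact: (notin_count ns).
move: Oo; rewrite in_cons mem_cat => /or3P[/eqP o_a|o_p|o_q].
- apply: (IHn y' r2 (p ++ y :: s1) s2) => //; [by rewrite -o_a|exact: ext|].
  by apply/uniq_countP => z; case: (cts z); rewrite eq_s /= !count_cat /= !count_cat /=; clear; lia.
- have [p1 [p2 eq_p]] := mem_split o_p.
  apply: (IHn y' (p1 ++ o :: r2) (q ++ y :: s1) s2) => //; [|exact: ext|].
    move: py; rewrite eq_p !rcons_cat !cat_path /= => /and3P[-> -> _] /=; exact: o_r2.
  apply/uniq_countP => z; case: (cts z).
  by rewrite eq_s eq_p /= !count_cat /= !count_cat /=; clear; lia.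
- have [p1 [p2 eq_p]] := mem_split o_q.
  apply: (IHn y' (p1 ++ o :: r2) (p ++ y :: s1) s2) => //; [|exact: ext|].
    move: qy; rewrite eq_p !rcons_cat !cat_path /= => /and3P[-> -> _] /=; exact: o_r2.
  apply/uniq_countP => z; case: (cts z).
  by rewrite eq_s eq_p /= !count_cat /= !count_cat /=; clear; lia.
Qed.
End Menger.

(** * Walks and edge cuts *)

Lemma connect_crossing (T : finType) (e : rel T) (X : {set T}) x y :
  connect e x y -> x \in X -> y \notin X ->
  exists x' y', [/\ x' \in X, y' \notin X & e x' y'].
Proof.
case/connectP => p; elim: p x => [|z p IHp] x /=.
  by move=> _ -> ->.
case/andP => exz /IHp{}IHp /IHp{}IHp xX yX.
by case: (boolP (z \in X)) => [/IHp/(_ yX)//|zX]; exists x, z.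
Qed.

Section Graph.
Variable G : sgraph.
Implicit Types (x y z u v w a b c : G) (X Y D A : {set G}) (p q r s : seq G).

Lemma adj_neq x y : adj x y -> x != y.
Proof. by apply: contraTneq => ->; rewrite adj_irr. Qed.

(** Walks are given by their end points and the list of inner vertices, so that
    reversing and joining them only acts on that list. *)
Definition walk x s y := path (@adj G) x (rcons s y).

Lemma walk_cat x s z t y : walk x (s ++ z :: t) y = walk x s z && walk z t y.
Proof. by rewrite /walk -cat_rcons rcons_cat cat_path last_rcons. Qed.

Lemma walk_cons x y s z : walk x (y :: s) z = adj x y && walk y s z.
Proof. by []. Qed.

Lemma walk_rcons x y s z : walk x (rcons s y) z = walk x s y && adj y z.
Proof. by rewrite /walk rcons_path last_rcons. Qed.

Lemma walk_rev x s y : walk x s y = walk y (rev s) x.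
Proof.
elim: s x => [|z s IHs] x; first by rewrite /walk /= adj_sym.
by rewrite rev_cons walk_rcons walk_cons IHs andbC adj_sym.
Qed.

Lemma walk_cycle x s y t : walk x s y -> walk y t x -> cycle (@adj G) (x :: s ++ y :: t).
Proof. by move=> xy yx; have: walk x (s ++ y :: t) x by rewrite walk_cat xy. Qed.

Lemma cycle_walk x s : cycle (@adj G) (x :: s) = walk x s x.
Proof. by []. Qed.

(** Edges between two sets, oriented from [X] to [Y]: an edge inside
    [X :&: Y] counts twice. *)
Definition darts X Y : {set G * G} :=
  [set d | [&& d.1 \in X, d.2 \in Y & adj d.1 d.2]].

Lemma in_darts X Y x y : ((x, y) \in darts X Y) = [&& x \in X, y \in Y & adj x y].
Proof. by rewrite inE. Qed.

Lemma card_darts_sym X Y : #|darts X Y| = #|darts Y X|.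
Proof.
pose swap (d : G * G) := (d.2, d.1).
have swapK : involutive swap by case.
rewrite -(card_imset _ (inv_inj swapK)); apply: eq_card => -[x y].
rewrite -[(x, y)]swapK mem_imset; last exact: inv_inj.
by rewrite !inE /= adj_sym andbCA.
Qed.

Lemma dartsUr X Y1 Y2 : darts X (Y1 :|: Y2) = darts X Y1 :|: darts X Y2.
Proof. by apply/setP => d; rewrite !inE; case: (_ \in X); case: adj; rewrite ?andbT ?andbF. Qed.

Lemma card_dartsUr X Y1 Y2 : [disjoint Y1 & Y2] ->
  #|darts X (Y1 :|: Y2)| = #|darts X Y1| + #|darts X Y2|.
Proof.
move=> dis; rewrite dartsUr cardsU -[RHS]subn0; congr (_ - _); apply: eq_card0 => d.
rewrite !inE; apply/negP => /andP[/and3P[_ Y1d _] /and3P[_ Y2d _]].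
by rewrite (disjointFr dis Y1d) in Y2d.
Qed.

Lemma card_dartsC X Y : #|darts X setT| = #|darts X Y| + #|darts X (~: Y)|.
Proof. by rewrite -card_dartsUr ?setUCr // -setI_eq0 setICr. Qed.

Lemma dartsS X X' Y Y' : X \subset X' -> Y \subset Y' -> #|darts X Y| <= #|darts X' Y'|.
Proof.
move=> /subsetP sX /subsetP sY; apply/subset_leq_card/subsetP => d.
by rewrite !inE => /and3P[/sX-> /sY-> ->].
Qed.

Lemma matching_fun N : perfect_matching [set: G] N ->
  exists m : G -> G, [/\ involutive m, forall x, adj x (m x)
                       & forall x y, adj x y -> [set x; y] \in N -> m x = y].
Proof.
case=> -[/subsetP Nedges /trivIsetP Ntriv] covN.
have ex x : exists y, adj x y && ([set x; y] \in N).
  have: x \in cover N by rewrite covN inE.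
  case/bigcupP => B BN xB; case/imset2P: (Nedges B BN) => y z _; rewrite !inE => /andP[_ yz] eqB.
  move: xB BN; rewrite eqB !inE => /orP[]/eqP-> BN; first by exists z; rewrite yz.
  by exists y; rewrite adj_sym yz setUC.
pose m x := xchoose (ex x).
have mP x : adj x (m x) /\ [set x; m x] \in N by apply/andP; exact: (xchooseP (ex x)).
have muniq x y : adj x y -> [set x; y] \in N -> m x = y.
  move=> xy xyN; have [xm xmN] := mP x.
  case: (eqVneq [set x; y] [set x; m x]) => [/setP/(_ y)|/(Ntriv _ _ xyN xmN)].
    rewrite !inE eqxx orbT [y == x]eq_sym (negPf (adj_neq xy)) /=.
    by move/esym/eqP.
  by move/disjointFr/(_ (set21 _ _)); rewrite set21.
exists m; split=> // x; first apply: muniq.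
- by rewrite adj_sym; case: (mP x).
- by rewrite setUC; case: (mP x).
by case: (mP x).
Qed.

Section Brace.
Hypothesis cubicG : cubic G.
Hypothesis braceG : brace G.

Lemma cubic_nbr z x1 x2 x3 y : uniq [:: x1; x2; x3] ->
  adj z x1 -> adj z x2 -> adj z x3 -> adj z y -> y \in [:: x1; x2; x3].
Proof.
move=> u123 z1 z2 z3 zy; rewrite -[_ \in _](inE).
have /setP/(_ y): [set x in [:: x1; x2; x3]] = [set x | adj z x].
  apply/eqP; rewrite eqEcard cubicG cardsE (card_uniqP u123) leqnn andbT.
  by apply/subsetP => x; rewrite !inE => /or3P[]/eqP->.
by rewrite !inE zy.
Qed.

Lemma card_darts_out X : #|darts X setT| = 3 * #|X|.
Proof.
rewrite -sum1_card (eq_bigl (fun d => (d.1 \in X) && adj d.1 d.2)); last by move=> d; rewrite !inE.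
rewrite -(pair_big_dep (mem X) (fun x y => adj x y) (fun _ _ => 1)) /=.
rewrite mulnC -sum_nat_const; apply: eq_bigr => x _.
by rewrite sum1_card -(cubicG x); apply: eq_card => y; rewrite inE.
Qed.

Lemma extend_two_edges x1 y1 x2 y2 :
    adj x1 y1 -> adj x2 y2 -> x1 != x2 -> x1 != y2 -> y1 != x2 -> y1 != y2 ->
  exists m : G -> G, [/\ involutive m, forall x, adj x (m x), m x1 = y1 & m x2 = y2].
Proof.
move=> e1 e2 n1 n2 n3 n4; case: braceG => _ _ /(_ [set [set x1; y1]; [set x2; y2]]).
have mM : matching [set: G] [set [set x1; y1]; [set x2; y2]].
  split; first by apply/subsetP => B; rewrite !inE => /orP[]/eqP->;
    apply/imset2P; [exists x1 y1|exists x2 y2]; rewrite ?inE.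
  have dis : [disjoint [set x1; y1] & [set x2; y2]].
    rewrite -setI_eq0; apply/eqP/setP => z; rewrite !inE; apply/negP => /andP[/orP[]/eqP-> /orP[]];
    by apply/negP.
  apply/trivIsetP => A B; rewrite !inE => /orP[]/eqP-> /orP[]/eqP->; rewrite ?eqxx //.
  by rewrite disjoint_sym.
case/(_ mM) => [|N /matching_fun[m [mK madj muniq]] /subsetP sub].
  by rewrite cards2; case: eqVneq.
exists m; split=> //; apply: muniq => //; apply: sub; rewrite !inE eqxx ?orbT //.
Qed.

Section Coloured.
Variable f : G -> bool.
Hypothesis fP : forall x y, adj x y -> f x != f y.
Variable X : {set G}.
Let W := [set x in X | f x].
Let B := [set x in X | ~~ f x].

(** Both sides count edges at the two colour classes of [X]; the edges inside
    [X] cancel. *)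
Lemma cubic_balance : 3 * #|W| + #|darts B (~: X)| = 3 * #|B| + #|darts W (~: X)|.
Proof.
rewrite -!card_darts_out !(card_dartsC _ X).
suff -> : #|darts W X| = #|darts B X| by lia.
have -> : darts W X = darts W B.
  apply/setP => d; rewrite !inE; case: (boolP (adj _ _)) => [/fP|]; rewrite ?andbF //.
  by case: (f d.1); case: (f d.2); rewrite ?andbF ?andbT.
have -> : darts B X = darts B W.
  apply/setP => d; rewrite !inE; case: (boolP (adj _ _)) => [/fP|]; rewrite ?andbF //.
  by case: (f d.1); case: (f d.2); rewrite ?andbF ?andbT.
exact: card_darts_sym.
Qed.

Variable m : G -> G.
Hypothesis mK : involutive m.
Hypothesis madj : forall x, adj x (m x).
Let crossing (Y : {set G}) := [set x in Y | m x \notin X].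

(** The matching pairs the rest of [W] with the rest of [B]. *)
Lemma matching_balance : #|W| + #|crossing B| = #|B| + #|crossing W|.
Proof.
have split_card Y : #|Y| = #|[set x in Y | m x \in X]| + #|crossing Y|.
  rewrite -(cardsID [set x | m x \in X] Y); congr (_ + _); apply: eq_card => x;
  by rewrite !inE // andbC.
rewrite (split_card W) (split_card B).
suff -> : #|[set x in W | m x \in X]| = #|[set x in B | m x \in X]| by lia.
rewrite -(card_imset _ (inv_inj mK)); apply: eq_card => x.
rewrite -{1}[x]mK mem_imset; last exact: inv_inj.
rewrite !inE mK; have := fP (madj x).
by case: (f x); case: (f _); case: (x \in X); case: (_ \in X).
Qed.

Lemma card_crossing (Y : {set G}) : #|crossing Y| <= #|darts Y (~: X)|.
Proof.
have inj : injective (fun x => (x, m x)) by move=> x y [].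
rewrite -(card_imset _ inj); apply/subset_leq_card/subsetP => _ /imsetP[x + ->].
by rewrite !inE /= madj andbT.
Qed.

End Coloured.

(** If all edges of the cut shared an end point, removing it would disconnect
    the graph. *)
Lemma two_disjoint_cut_edges X : 1 < #|X| -> 1 < #|~: X| ->
  exists x1 y1 x2 y2,
    [/\ x1 != x2, y1 != y2 & [/\ x1 \in X, x2 \in X, y1 \notin X & y2 \notin X]
      /\ adj x1 y1 /\ adj x2 y2].
Proof.
case: braceG => -[_ conn2] _ _ X2 Y2.
have another (Y : {set G}) z : 1 < #|Y| -> exists2 x, x \in Y & x != z.
  move=> Y1; have: 0 < #|Y :\ z| by have := cardsD1 z Y; case: (_ \in _); lia.
  by case/card_gt0P => x; rewrite !inE => /andP[]; exists x.
have cut_edge z : exists x y, [/\ x \in X, y \notin X, adj x y, x != z & y != z].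
  have [x xX nxz] := another X z X2; have [y yX nyz] := another (~: X) z Y2.
  have z1 : #|[set z]| < 2 by rewrite cards1.
  have [_ /(_ x y)] := conn2 [set z] z1.
  rewrite !inE => /(_ nxz nyz) /connect_crossing/(_ xX); rewrite inE in yX => /(_ yX).
  by case=> x' [y' [? ? /and3P[]]]; rewrite !inE => *; exists x', y'.
have /card_gt0P[x0 _] : 0 < #|X| by apply: ltnW.
have [x1 [y1 [xX1 yX1 e1 _ _]]] := cut_edge x0.
have [x2 [y2 [xX2 yX2 e2 n12 _]]] := cut_edge x1.
case: (eqVneq y1 y2) => [y12|]; last by exists x1, y1, x2, y2; rewrite eq_sym n12.
have [x3 [y3 [xX3 yX3 e3 _ n13]]] := cut_edge y1.
case: (eqVneq x1 x3) => [x13|]; last by exists x1, y1, x3, y3; rewrite [y1 == _]eq_sym n13.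
by exists x2, y2, x3, y3; split=> //; [rewrite -x13 | rewrite -y12 eq_sym].
Qed.

(** The numbers of cut edges at the two colour classes of [X] are congruent
    modulo 3 by [cubic_balance], so a nonempty cut of size at most three has
    either three edges, all at the same class, or two edges, one at each class.
    By [cubic_balance] and [matching_balance] a perfect matching crosses the cut
    at the first class exactly once more than at the second in the former case,
    and equally often in the latter.  Extending a suitable pair of disjoint
    edges to a perfect matching contradicts this: two cut edges in the former
    case, and in the latter the cut edge at one class together with an edge that
    occupies the end of the other cut edge. *)
Lemma brace_cut X : 1 < #|X| -> 1 < #|~: X| -> 3 < #|darts X (~: X)|.
Proof.
move=> X2 Y2; have [x1 [y1 [x2 [y2 [nx ny [[xX1 xX2 yX1 yX2] [e1 e2]]]]]]] :=
  two_disjoint_cut_edges X2 Y2.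
have n12 : x1 != y2 by apply: contraNneq yX2 => <-.
have n21 : y1 != x2 by apply: contraNneq yX1 => ->.
have [_ [f0 f0P] _] := braceG; rewrite ltnNge; apply/negP => le3.
have [f [fP fx1]] : exists f : G -> bool, (forall x y, adj x y -> f x != f y) /\ f x1.
  case: (boolP (f0 x1)) => fx1; first by exists f0.
  by exists (negb \o f0); split=> // x y /f0P; rewrite /= (inj_eq negb_inj).
have := cubic_balance fP X; set W := [set x in X | f x]; set B := [set x in X | ~~ f x].
have le3' : #|darts W (~: X)| + #|darts B (~: X)| <= 3.
  apply: leq_trans le3; rewrite card_darts_sym [X in _ + X]card_darts_sym [leqRHS]card_darts_sym.
  rewrite -card_dartsUr.
    by apply: dartsS => //; apply/subsetP => x; rewrite !inE => /orP[]/andP[].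
  rewrite -setI_eq0; apply/eqP/setP => x; rewrite !inE; by case: (f x); rewrite ?andbF.
have dart Y x y : x \in Y -> y \notin X -> adj x y -> (x, y) \in darts Y (~: X).
  by move=> xY yX xy; rewrite !inE /= xY yX xy.
have xW1 : x1 \in W by rewrite inE xX1.
have dW1 : 0 < #|darts W (~: X)| by apply/card_gt0P; exists (x1, y1); apply: dart.
case: (boolP (f x2)) => fx2 balance.
  have [m [mK madj mx1 mx2]] := extend_two_edges e1 e2 nx n12 n21 ny.
  have := matching_balance fP X mK madj.
  have := card_crossing X madj B.
  have : 1 < #|[set x in W | m x \notin X]|.
    rewrite (cardsD1 x1) (cardsD1 x2) !inE mx1 mx2 xX1 xX2 fx1 fx2 yX1 yX2 /=.
    by rewrite eq_sym nx.
  have := card_crossing X madj W; rewrite -/W -/B.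
  by clear -le3' dW1 balance; lia.
have xB2 : x2 \in B by rewrite inE xX2.
have dB1 : 0 < #|darts B (~: X)| by apply/card_gt0P; exists (x2, y2); apply: dart.
have [dW eqWB] : #|darts W (~: X)| = 1 /\ #|W| = #|B| by clear -le3' dW1 dB1 balance; lia.
(* The edge from [x1] to [b] keeps the only cut edge at [x1] out of a matching
   that contains the cut edge at [x2]. *)
have [b /andP[e1b nb]] : exists b, adj x1 b && (b \notin [set y1; x2]).
  have: 0 < #|[set y | adj x1 y] :\: [set y1; x2]|.
    have := cardsID [set y1; x2] [set y | adj x1 y]; rewrite cubicG.
    have := subset_leq_card (subsetIr [set y | adj x1 y] [set y1; x2]).
    by rewrite cards2; clear; case: (y1 != x2); lia.
  by case/card_gt0P => b; rewrite inE andbC => bP; exists b; rewrite inE in bP.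
move: nb; rewrite !inE => /norP[nby1 nbx2].
have nby2 : b != y2.
  apply/eqP => b_y2.
  have: #|[set (x1, y1); (x1, b)]| <= #|darts W (~: X)|.
    apply/subset_leq_card/subsetP => d; rewrite inE => /orP[]/set1P->; apply: dart => //.
    by rewrite b_y2.
  by rewrite dW cards2 xpair_eqE eqxx eq_sym nby1.
have [m [mK madj mx1 mx2]] := extend_two_edges e1b e2 nx n12 nbx2 nby2.
have := matching_balance fP X mK madj; rewrite -/W -/B.
have -> : #|[set x in W | m x \notin X]| = 0.
  apply: eq_card0 => x; apply/negP; rewrite inE => /andP[xW mxX].
  have: [set (x1, y1); (x, m x)] \subset darts W (~: X).
    by apply/subsetP => d; rewrite inE => /orP[]/set1P->; apply: dart.
  move/subset_leq_card; rewrite dW cards2; case: eqVneq => // -[eqx eqy] _.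
  by rewrite -eqx mx1 in eqy; rewrite eqy eqxx in nby1.
have : 0 < #|[set x in B | m x \notin X]|.
  by apply/card_gt0P; exists x2; rewrite !inE xX2 fx2 mx2.
by clear -eqWB; lia.
Qed.

Lemma card_darts1 x : #|darts [set x] (~: [set x])| = 3.
Proof.
have := card_darts_out [set x]; rewrite (card_dartsC _ [set x]) cards1 muln1 => <-.
rewrite [X in X + _]eq_card0 // => -[y z]; rewrite !inE /=.
by apply/negP => /and3P[/eqP-> /eqP->]; rewrite adj_irr.
Qed.

Lemma brace_cut_ge3 X x y : x \in X -> y \notin X -> 2 < #|darts X (~: X)|.
Proof.
move=> xX yX.
case: (leqP #|X| 1) => [X1|X2].
  have -> : X = [set x] by apply/esym/eqP; rewrite eqEcard sub1set xX cards1.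
  by rewrite card_darts1.
case: (leqP #|~: X| 1) => [Y1|Y2]; last by apply: ltnW; apply: brace_cut.
have eqX : ~: X = [set y] by apply/esym/eqP; rewrite eqEcard sub1set inE yX cards1.
by rewrite card_darts_sym -[X in darts _ X]setCK eqX card_darts1.
Qed.

(** At most six edges leave [v] and [z], and by [brace_cut] each of two parts
    into which the rest falls would need at least four of them. *)
Lemma brace_three_connected v z x y :
    x != v -> x != z -> y != v -> y != z ->
  connect [rel x y | [&& adj x y, y != v & y != z]] x y.
Proof.
move=> xv xz yv yz; apply: contraT => nxy.
set e := [rel x y | _] in nxy; pose X := [set x' | connect e x x'].
pose Y := ~: (X :|: [set v; z]).
have vz_notX u : u \in [set v; z] -> u \notin X.
  rewrite !inE => uvz; apply/negP => /connectP[p]; case/lastP: p => [_ /= ux|p u'].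
    by move: uvz; rewrite ux (negPf xv) (negPf xz).
  rewrite rcons_path last_rcons => /andP[_ /and3P[_ nv nz]] uu'.
  by move: uvz; rewrite uu' (negPf nv) (negPf nz).
have yY : y \in Y by rewrite !inE negb_or nxy negb_or yv yz.
have xX : x \in X by rewrite inE connect0.
have large (Z : {set G}) u u' : u \in Z -> v \notin Z -> u' \notin Z -> v != u' ->
    (forall p q : G, p \in Z -> q \notin Z -> adj p q -> q \in [set v; z]) ->
    3 < #|darts Z [set v; z]|.
  move=> uZ vZ u'Z vu' out.
  have : #|darts Z (~: Z)| <= #|darts Z [set v; z]|.
    apply/subset_leq_card/subsetP => -[p q]; rewrite !inE /= => /and3P[pZ qZ pq].
    by have := out p q pZ qZ pq; rewrite !inE pZ pq => ->.
  apply: leq_trans; apply: brace_cut.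
    rewrite ltnNge; apply/negP => Z1.
    have eqZ : Z = [set u] by apply/esym/eqP; rewrite eqEcard sub1set uZ cards1.
    have: [set q | adj u q] \subset [set v; z].
      apply/subsetP => q; rewrite inE => uq; apply: (out u q) => //.
      by rewrite eqZ inE eq_sym adj_neq.
    by move/subset_leq_card; rewrite cubicG cards2; case: eqP.
  have: [set v; u'] \subset ~: Z by apply/subsetP => q; rewrite !inE => /orP[]/eqP->.
  by move/subset_leq_card; rewrite cards2 vu'.
have outX (p q : G) : p \in X -> q \notin X -> adj p q -> q \in [set v; z].
  rewrite !inE => xp xq pq; apply: contraR xq => /norP[qv qz].
  by apply: connect_trans xp _; apply: connect1; rewrite /= pq qv qz.
have DX : 3 < #|darts X [set v; z]|.
  by apply: (large X x y) => //; [exact/vz_notX/set21 | rewrite inE | rewrite eq_sym].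
have DY : 3 < #|darts Y [set v; z]|.
  apply: (large Y y x) => //; first by rewrite !inE eqxx orbT.
  - by rewrite inE negbK inE xX.
  - by rewrite eq_sym.
  move=> p q; rewrite inE in_setU => /norP[pX pvz]; rewrite inE negbK in_setU => /orP[qX|//].
  by rewrite adj_sym => /(outX _ _ qX pX); rewrite (negPf pvz).
have dis : [disjoint X & Y].
  by rewrite -setI_eq0; apply/eqP/setP => q; rewrite !inE; case: connect.
have := dartsS (subxx [set v; z]) (subsetT (X :|: Y)).
rewrite card_dartsUr // card_darts_out cards2.
rewrite -(card_darts_sym X) -(card_darts_sym Y) => le6.
by move: le6 DX DY; clear; case: (v != z) => /=; lia.
Qed.

End Brace.
End Graph.

(** * Ears *)

Section Ear.
Variable G : sgraph.
Implicit Types (x y z u v w a b c : G) (X Y D A O : {set G}) (p q r s : seq G).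
Hypothesis cubicG : cubic G.

Definition ear (O A : {set G}) a x r y :=
  [/\ walk x r y, [/\ x \in A, y \in A & a \in r],
      {in r, forall z, z \in O} & uniq (x :: y :: r)].

Lemma ear_rev O A a x r y : ear O A a x r y -> ear O A a y (rev r) x.
Proof.
case=> xy [xA yA ar] rO u; split; rewrite -?walk_rev ?mem_rev //.
  by move=> z; rewrite mem_rev => /rO.
by move: u; rewrite /= !inE !mem_rev rev_uniq !negb_or eq_sym;
  case: (x \in r); case: (y \in r); rewrite ?andbF ?andbT.
Qed.

(** Menger's theorem for two disjoint paths from [a] through [O] to [A], in a
    form with edge cuts: since degrees are at most three, a separating vertex
    [z] sends at most one edge to one of its two sides, and [z] can be put on
    the other side of the cut (for [z] in [A] the bound is assumed).  The paths
    are led from [A] to the single vertex [v] outside, which serves as the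
    target in [two_paths]. *)
Lemma ear_or_cut O A a v :
    [disjoint O & A] -> a \in O -> v \notin O :|: A ->
    {in A, forall x, {in O &, forall y1 y2, adj x y1 -> adj x y2 -> y1 = y2}} ->
  (exists x r y, ear O A a x r y) \/
  (exists X, [/\ a \in X, X \subset O & #|darts X ((O :|: A) :\: X)| <= 1]).
Proof.
move=> disOA; have := subsetUr O A; have : (O :|: A) :\: A = O.
  by rewrite setDUl setDv setU0; apply/setDidPl.
move: (O :|: A) => D <- /subsetP sAD aDA vD A1.
have [aD aA] : a \in D /\ a \notin A by apply/andP; rewrite andbC -in_setD.
(* From [A] the only step leads to [v], and no other step does, so a path to
   [v] stays in [O] until its last vertex before [v], which is in [A]. *)
pose e := [rel x y | if x \in A then y == v else adj x y && (y \in D)].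
have av : a != v by apply: contraNneq vD => <-.
case: (boolP [forall z, (z != a) ==> connect (avoiding e v z) a v]) => [/forallP conn|].
  left; have [|p [q [pav qav upq]]] := @two_paths _ e _ _ av.
    by move=> z za; apply: (implyP (conn z)).
  have path_inside s b x : path e b (rcons s x) -> v \notin rcons s x ->
      [/\ walk b s x, {in s, forall z, z \in D :\: A} & b \notin A].
    elim: s b => [|y s IHs] b.
      rewrite /walk /= inE andbT; case: ifP => [_ /eqP->|]; first by rewrite eqxx.
      by rewrite andbT => _ /andP[bx _] _; split.
    rewrite rcons_cons /= inE negb_or => /andP[+ /IHs{}IHs] /andP[vy /IHs[sw sDA yA]].
    case: ifP => [_|_ /andP[b_y yD]]; first by rewrite eq_sym (negPf vy).
    split=> //; first by rewrite walk_cons b_y.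
    by move=> z; rewrite inE => /predU1P[->|/sDA//]; rewrite inE yA.
  have last_step s : path e a (rcons s v) -> v \notin s -> exists s' x,
      [/\ s = rcons s' x, x \in A, walk a s' x & {in s', forall z, z \in D :\: A}].
    case/lastP: s => [|s x]; first by rewrite /= (negPf aA) (negPf vD) andbF.
    rewrite rcons_path last_rcons => /andP[/path_inside h + /h[sw sDA _]] => /=.
    case: ifP => [xA _|]; first by exists s, x.
    by rewrite (negPf vD) andbF.
  have /= /andP[] := upq.
  rewrite inE negb_or mem_cat => _ /andP[]; rewrite mem_cat => /norP[vp vq] _.
  have [p' [x [eqp xA wp pD]]] := last_step p pav vp.
  have [q' [y [eqq yA wq qD]]] := last_step q qav vq.
  exists x, (rev p' ++ a :: q'), y; split; rewrite ?walk_cat -?walk_rev ?wp //.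
  - by split; rewrite // mem_cat mem_head orbT.
  - by move=> z; rewrite mem_cat mem_rev inE => /or3P[/pD|/eqP->|/qD].
  apply/uniq_countP => z; move/uniq_countP/(_ z): upq; rewrite eqp eqq /=.
  by rewrite !count_cat -!cats1 !count_cat /= count_rev; clear; lia.
rewrite negb_forall => /existsP[z]; rewrite negb_imply => /andP[za nconn]; right.
set ez := avoiding e v z in nconn; pose X0 := [set x | connect ez a x].
have X0v : v \notin X0 by rewrite inE.
have step x y : x \in X0 -> e x y -> (y == v) || (y != z) -> y \in X0.
  rewrite !inE => ax exy yz; apply: connect_trans ax _; apply: connect1.
  by rewrite /ez /avoiding /= -/(e x y) exy.
have X0A x : x \in X0 -> x \notin A.
  move=> xX; apply: contraNN X0v => xA; apply: step xX _ _; last by rewrite eqxx.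
  by rewrite /= xA.
have X0D x : x \in X0 -> x \in D.
  rewrite inE => /connectP[s]; case/lastP: s => [_ -> //|s x'].
  rewrite rcons_path last_rcons => /andP[sp /andP[/= exx' _]] eqx.
  rewrite -eqx in exx'; move: exx'; case: ifP => [lA|_ /andP[]//] _.
  have : last a s \in X0 by rewrite inE; apply/connectP; exists s.
  by move/X0A; rewrite lA.
have X0z x y : x \in X0 -> y \in D -> y \notin X0 -> adj x y -> y = z.
  move=> xX yD yX xy; apply/eqP; apply: contraR yX => yz; apply: (step x y xX).
    by rewrite /= (negPf (X0A x xX)) xy.
  by rewrite yz orbT.
have aX0 : a \in X0 by rewrite inE connect0.
have le1 X : (forall d1 d2, d1 \in darts X (D :\: X) -> d2 \in darts X (D :\: X) -> d1 = d2) ->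
    #|darts X (D :\: X)| <= 1.
  by move=> h; apply/card_le1_eqP => d1 d2 ? ?; apply: h.
have inX0 x : x \in X0 -> x \in D :\: A by move=> xX; rewrite inE X0A // X0D.
(* If two edges lead from [X0] to [z], then at most one other edge is at [z],
   and [z] is moved to the side of [a]. *)
case: (leqP #|darts X0 (D :\: X0)| 1) => [X0cut|].
  by exists X0; split=> //; apply/subsetP.
case/card_gt1P => -[x1 z1] [[x2 z2] []]; rewrite !in_darts !in_setD.
case/and3P => xX1 /andP[zX1 zD1] e1; case/and3P => xX2 /andP[zX2 zD2] e2.
have zz1 := X0z _ _ xX1 zD1 zX1 e1; have zz2 := X0z _ _ xX2 zD2 zX2 e2.
subst z1 z2; rewrite xpair_eqE eqxx andbT => x12.
have zA : z \notin A.
  apply/negP => zA; move/eqP: x12; apply.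
  apply: (A1 z zA); rewrite ?inX0 //; by rewrite adj_sym.
exists (z |: X0); split; first by rewrite inE aX0 orbT.
  by apply/subsetP => x; rewrite in_setU1 => /predU1P[->|/inX0//]; rewrite inE zA.
have headz d : d \in darts (z |: X0) (D :\: (z |: X0)) -> d.1 = z /\ d.2 \notin [set x1; x2].
  case: d => x y; rewrite in_darts in_setU1 => /and3P[+ + xy].
  rewrite in_setD in_setU1 => + /andP[/norP[yz yX] yD].
  case/predU1P => [-> |xX]; last by rewrite (X0z x y) ?eqxx // in yz.
  by split=> //=; apply: contraNN yX; rewrite in_set2 => /orP[]/eqP->.
apply: le1 => -[z1 y1] [z2 y2] d1 d2.
have [/= eq1 n1] := headz _ d1; have [/= eq2 n2] := headz _ d2; subst z1 z2; congr (_, _).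
move: d1 d2; rewrite !in_darts => /and3P[_ _ zy1] /and3P[_ _ zy2].
have [n1x1 n1x2] : y1 != x1 /\ y1 != x2.
  by apply/andP; rewrite -negb_or -in_set2.
have [n2x1 n2x2] : y2 != x1 /\ y2 != x2.
  by apply/andP; rewrite -negb_or -in_set2.
have u12 : uniq [:: x1; x2; y1] by rewrite /= !inE negb_or x12 ![_ == y1]eq_sym n1x1 n1x2.
rewrite adj_sym in e1; rewrite adj_sym in e2.
have := cubic_nbr cubicG u12 e1 e2 zy1 zy2.
by rewrite !inE (negPf n2x1) (negPf n2x2) => /eqP.
Qed.
End Ear.

(** * Cycles through two neighbours of a vertex *)

Ltac count_lia :=
  rewrite -?cats1 /=; repeat (rewrite !(count_cat, count_rev) /=); clear; lia.
Ltac uniq_by_count H :=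
  let z := fresh "z" in
  apply/uniq_countP => z; move/uniq_countP/(_ z): H; count_lia.

Section Ring.
Variable G : sgraph.
Implicit Types (x y z u v w a b c : G) (X Y D A : {set G}) (p q r s : seq G).
Hypothesis cubicG : cubic G.
Hypothesis braceG : brace G.

(** In the application no cycle of [G - v] contains all neighbours of [v]
    because such a cycle would not be conformal, and the neighbours of [v] are
    pairwise non-adjacent because [G] is bipartite. *)
Variable v : G.
Hypothesis noCycle : forall s, cycle (@adj G) s -> uniq (v :: s) ->
  ~ (forall x, adj v x -> x \in s).
Hypothesis nadj : forall x y, adj v x -> adj v y -> ~~ adj x y.

Definition nbrs3 a b c := [/\ adj v a, adj v b, adj v c & uniq [:: a; b; c]].

Lemma nbrs3_rot a b c : nbrs3 a b c -> nbrs3 b c a.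
Proof. by case=> *; split=> //; rewrite -(rot_uniq 2). Qed.

Lemma nbrs3_mem a b c x : nbrs3 a b c -> adj v x -> x \in [:: a; b; c].
Proof. case=> va vb vc u; exact: cubic_nbr. Qed.

Lemma nbrs3_no_cycle a b c s : nbrs3 a b c ->
  cycle (@adj G) s -> uniq (v :: s) -> a \in s -> b \in s -> c \in s -> False.
Proof.
move=> n3 cs us sa sb sc; apply: (noCycle cs us) => x /(nbrs3_mem n3).
by rewrite !inE => /or3P[]/eqP->.
Qed.

(** A cycle of [G - v] through [b] and [c], given by its two arcs. *)
Definition ring b c p q := [/\ walk b p c, walk b q c & uniq (v :: b :: c :: p ++ q)].

Lemma ring_swap b c p q : ring b c p q -> ring b c q p.
Proof. by case=> wp wq u; split=> //; uniq_by_count u. Qed.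

Lemma ring_rev b c p q : ring b c p q -> ring c b (rev p) (rev q).
Proof. by case=> wp wq u; split; rewrite -?walk_rev //; uniq_by_count u. Qed.

Definition outside b c p q := [set z | z \notin v :: b :: c :: p ++ q].

Lemma outside_swap b c p q : outside b c q p = outside b c p q.
Proof. by apply/setP => z; rewrite !inE !mem_cat [(z \in q) || _]orbC. Qed.

Lemma ring_exists a b c : nbrs3 a b c -> exists p q, ring b c p q.
Proof.
case=> _ vb vc; rewrite /= !inE negb_or andbT => /andP[_ bc].
have vneq x : adj v x -> x != v by move/adj_neq; rewrite eq_sym.
pose e := [rel x y : G | adj x y && (y != v)].
have [|p [q [pbc qbc u]]] := @two_paths _ e _ _ bc.
  (* The vertices to remove are [v] and [z], except that for [z = c] only [v]
     has to be avoided. *)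
  move=> z zb; pose z' := if z == c then v else z.
  have := @brace_three_connected _ cubicG braceG v z' b c.
  rewrite !vneq //; have -> : b != z' by rewrite /z'; case: ifP => _; rewrite ?vneq // eq_sym.
  have -> : c != z' by rewrite /z'; case: (eqVneq z c) => [_|]; [exact: vneq | rewrite eq_sym].
  move=> /(_ isT isT isT isT); apply: connect_sub => x y /and3P[xy yv yz].
  apply: connect1; rewrite /avoiding /= xy yv /=; case: eqVneq => //= yc.
  by move: yz; rewrite /z'; case: (eqVneq z c) => [->|].
have ewalk s x y : path e x (rcons s y) -> walk x s y && (v \notin s).
  elim: s x => [|z s IHs] x /=; first by rewrite /walk /= !andbT => /andP[].
  by case/andP => /andP[xz zv] /IHs/andP[sw vs]; rewrite walk_cons xz sw inE negb_or eq_sym zv.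
have /andP[wp vp] := ewalk _ _ _ pbc; have /andP[wq vq] := ewalk _ _ _ qbc.
exists p, q; split=> //; rewrite cons_uniq u andbT !inE mem_cat !negb_or vp vq.
by rewrite ![v == _]eq_sym !vneq.
Qed.

Lemma ring_end b c p q x : adj v b -> adj v c -> ring b c p q -> adj b x -> x \in v :: p ++ q.
Proof.
move=> vb vc [wp wq u].
have nbc := negPf (nadj vb vc).
case: p q wp wq u => [|x1 p] [|x2 q] wp wq u; move: wp wq; rewrite /walk /= ?nbc //.
move=> /andP[bx1 _] /andP[bx2 _] bx.
have u3 : uniq [:: v; x1; x2] by uniq_by_count u.
rewrite adj_sym in vb; have := cubic_nbr cubicG u3 vb bx1 bx2 bx.
by rewrite !inE mem_cat inE => /or3P[]->; rewrite ?orbT.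
Qed.

(** Two of the three edges at an inner vertex of an arc belong to the ring. *)
Lemma ring_inner b c p q x : ring b c p q -> x \in p ->
  {in outside b c p q &, forall y1 y2, adj x y1 -> adj x y2 -> y1 = y2}.
Proof.
move=> [wp _ u] xp y1 y2; rewrite /outside !in_set => out1 out2 xy1 xy2.
have [p1 [p2 eqp]] := mem_split xp; move: wp; rewrite eqp walk_cat => /andP[w1 w2].
have [l [ll xl]] : exists l, l \in b :: p1 /\ adj x l.
  exists (last b p1); rewrite mem_last; split=> //.
  by move: w1; rewrite /walk rcons_path => /andP[_]; rewrite adj_sym.
have [h [hh xh]] : exists h, h \in c :: p2 /\ adj x h.
  case: (p2) w2 => [|h p3]; rewrite /walk /= => /andP[? _].
    by exists c; rewrite mem_head.
  by exists h; rewrite !inE eqxx orbT.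
have lr : l \in v :: b :: c :: p ++ q.
  by move: ll; rewrite eqp !(inE, mem_cat) => /orP[]->; rewrite ?orbT.
have hr : h \in v :: b :: c :: p ++ q.
  by move: hh; rewrite eqp !(inE, mem_cat) => /orP[]->; rewrite ?orbT.
have lh : l != h.
  apply: contraTneq hh => <-; apply/negP => ll'; move/uniq_countP/(_ l): u.
  move: ll ll'; rewrite -!has_pred1 !has_count eqp; count_lia.
have nout z y : z \in v :: b :: c :: p ++ q -> y \notin v :: b :: c :: p ++ q -> (y == z) = false.
  by move=> zr; apply: contraNF => /eqP->.
have u3 : uniq [:: l; h; y1].
  by rewrite /= !inE negb_or lh /= ![_ == y1]eq_sym !nout.
have := cubic_nbr cubicG u3 xl xh xy1 xy2.
by rewrite !in_cons in_nil orbF (nout l) // (nout h) //= => /eqP.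
Qed.

(** An ear through [a] with both ends in the same arc replaces the part of the
    arc between its ends, which gives a cycle through [a], [b] and [c]. *)
Lemma ring_ear_false a b c p q x r y : nbrs3 a b c -> ring b c p q ->
  ear (outside b c p q) [set z in p] a x r y -> False.
Proof.
move=> n3 [wp wq u] e0.
(* Reversing the ear if necessary, [x] precedes [y] on [p]. *)
wlog [p1 [p2 [p3 eqp]]] : x y r e0 / exists p1 p2 p3, p = p1 ++ x :: p2 ++ y :: p3.
  move=> main; case: (e0) => _ [xp yp _] _ uxy; rewrite !inE in xp yp.
  have [p1 [p2 eqp]] := mem_split xp; move: yp; rewrite eqp mem_cat inE.
  case/or3P => [/mem_split[p3 [p4 eqp1]]|/eqP xy|/mem_split[p3 [p4 eqp2]]].
  - apply: (main _ _ _ (ear_rev e0)); exists p3, p4, p2; by rewrite eqp eqp1 -catA.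
  - by move: uxy; rewrite xy /= inE eqxx.
  - by apply: (main _ _ _ e0); exists p1, p3, p4; rewrite eqp eqp2.
case: e0 => wr [_ _ ar] rO uxy.
move: wp; rewrite eqp !walk_cat => /and3P[w1 _ w3].
have := @nbrs3_no_cycle a b c (b :: (p1 ++ x :: r ++ y :: p3) ++ c :: rev q) n3.
case.
- by apply: walk_cycle; rewrite ?walk_cat ?w1 ?wr // -walk_rev.
- have disr : {in r, forall z, z \notin v :: b :: c :: p ++ q} by move=> z /rO; rewrite inE.
  apply/uniq_countP => z; have := notin_count disr z; move/uniq_countP/(_ z): uxy.
  move/uniq_countP/(_ z): u; rewrite eqp; count_lia.
- by rewrite !(inE, mem_cat) ar !orbT.
- by rewrite mem_head.
by rewrite !(inE, mem_cat) eqxx !orbT.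
Qed.

(** The neighbours of [b] and [c] other than [v] lie on the ring, and among the
    neighbours of [v] only [a] can lie outside it. *)
Lemma ring_boundary a b c p q X d : nbrs3 a b c -> ring b c p q ->
    X \subset outside b c p q -> d \in darts X (~: X) ->
  [\/ d = (a, v), d.2 \in outside b c p q :\: X, d.2 \in p | d.2 \in q].
Proof.
case: d => x y n3 rpq /subsetP sXO; rewrite in_darts inE => /and3P[xX yX xy].
have := sXO x xX; rewrite inE => xO.
have [_ vb vc _] := n3.
case: (boolP (y \in outside b c p q)) => yO; first by constructor 2; rewrite inE yX yO.
move: yO; rewrite inE negbK !(inE, mem_cat) /= => /or4P[/eqP yv|/eqP yb|/eqP yc|/orP[yp|yq]].
- subst y; constructor 1; move: xO; rewrite !inE !negb_or.
  rewrite adj_sym in xy; have := nbrs3_mem n3 xy.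
  by rewrite !inE => /or3P[]/eqP-> //; rewrite eqxx ?andbF.
- subst y; rewrite adj_sym in xy; have := ring_end vb vc rpq xy.
  by move: xO; rewrite !inE mem_cat => /norP[/negPf-> /norP[_ /norP[_ /negPf->]]].
- subst y; rewrite adj_sym in xy; have := ring_end vc vb (ring_rev rpq) xy.
  by move: xO; rewrite !inE !mem_cat !mem_rev => /norP[/negPf-> /norP[_ /norP[_ /negPf->]]].
- by constructor 3.
by constructor 4.
Qed.

(** A cycle that leaves [X] returns to it, so it uses two edges of the cut. *)
Lemma cycle_in_cut a o D X : cycle (@adj G) (a :: o) -> uniq (a :: o) -> 1 < size o ->
  {subset a :: o <= D} -> a \in X -> #|darts X (D :\: X)| <= 1 -> {subset o <= X}.
Proof.
rewrite cycle_walk => wo uo o2 oD aX le1.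
move=> z zo; apply: contraT => zX.
have hasX : has [pred x | x \notin X] o by apply/hasP; exists z.
have [o1 [y1 [o2' [eq1 yX1 in1]]]] := split_first hasX.
have [o3 [y2 [o4 [eq2 yX2 in2]]]] := split_last hasX.
rewrite /= in yX1 yX2 in1 in2.
have D1 : (last a o1, y1) \in darts X (D :\: X).
  rewrite in_darts in_setD yX1 oD; last by rewrite eq1 !(inE, mem_cat) eqxx !orbT.
  apply/and3P; split=> //.
    have: last a o1 \in a :: o1 by apply: mem_last.
    by rewrite inE => /predU1P[->//|/in1]; rewrite negbK.
  move: wo; rewrite eq1 walk_cat => /andP[+ _].
  by rewrite /walk rcons_path => /andP[].
have D2 : (last a (rev o4), y2) \in darts X (D :\: X).
  rewrite in_darts in_setD yX2 oD; last by rewrite eq2 !(inE, mem_cat) eqxx !orbT.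
  apply/and3P; split=> //.
    have: last a (rev o4) \in a :: rev o4 by apply: mem_last.
    by rewrite inE mem_rev => /predU1P[->//|/in2]; rewrite negbK.
  move: wo; rewrite eq2 walk_cat [walk y2 _ _]walk_rev => /andP[_].
  by rewrite /walk rcons_path => /andP[].
(* The first vertex outside [X] and the last one coincide, and so do their
   neighbours on the cycle in the two directions, so the cycle has at most two vertices. *)
move/card_le1_eqP/(_ _ _ D1 D2): le1 => -[eql eqy]; subst y1.
have aout : a \notin o by case/andP: uo.
move/eqP: (eq2); rewrite {1}eq1 uniq_eqseq_pivotl; last by rewrite -eq1; case/andP: uo.
case/andP => /eqP o13 /eqP o24.
move: eql uo aout o2; rewrite eq1 -o24.
case/lastP: (o1) => [|o1' l]; case: (o2') => [|h o2'']; rewrite ?rev_cons ?last_rcons //=.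
- by move=> <-; rewrite !inE eqxx orbT.
- by move=> ->; rewrite mem_cat mem_rcons inE eqxx.
move=> -> /andP[_ +] _ _; rewrite cat_uniq => /and3P[_ /negP[]].
by apply/hasP; exists l; rewrite ?inE /= ?mem_rcons ?inE ?eqxx ?orbT.
Qed.

(** Without an ear at [p], [ear_or_cut] yields a set [X1] containing [a] with at
    most one edge to the rest of the graph outside [q], [v], [b] and [c]; it
    contains the given cycle by [cycle_in_cut].  The same holds for [q] and a
    set [X2].  Apart from the edge from [a] to [v], an edge leaving
    [X1 :&: X2] is the one counted for [X1] or the one counted for [X2], so at
    most three edges leave that intersection, against [brace_cut]. *)
Lemma ring_off_cycle_false a b c p q o : nbrs3 a b c -> ring b c p q ->
    cycle (@adj G) (a :: o) -> uniq (a :: o) -> 1 < size o ->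
    {subset a :: o <= outside b c p q} -> False.
Proof.
move=> n3 rpq ca ua o2 oO; set O := outside b c p q in oO.
have aO : a \in O by rewrite oO ?mem_head.
have vring : v \notin O by rewrite !inE eqxx.
have side p' q' : ring b c p' q' -> outside b c p' q' = O ->
    exists X, [/\ {subset a :: o <= X}, X \subset O
      & #|darts X ((O :|: [set z in p']) :\: X)| <= 1].
  move=> r' eqO.
  have dis : [disjoint O & [set z in p']].
    rewrite -setI_eq0 -eqO; apply/eqP/setP => z; rewrite !inE mem_cat.
    by case: (z \in p'); rewrite ?andbF // !orbT.
  have vO : v \notin O :|: [set z in p'].
    rewrite inE negb_or vring inE; have [_ _ /= /andP[+ _]] := r'.
    by rewrite !inE mem_cat !negb_or => /and4P[].
  have [x|[x [r [y e]]]|[X [aX XO le1]]] := ear_or_cut cubicG dis aO vO.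
  - by rewrite inE -eqO => /(ring_inner r').
  - by case: (@ring_ear_false a b c p' q' x r y); rewrite ?eqO.
  exists X; split=> // z; rewrite inE => /predU1P[->//|].
  apply: cycle_in_cut ca ua o2 _ aX le1 _ => z' /oO z'O; by rewrite inE z'O.
have [X1 [o1 XO1 le1]] := side p q rpq erefl.
have [X2 [o2' XO2 le2]] := side q p (ring_swap rpq) (outside_swap _ _ _ _).
pose X := X1 :&: X2.
have oX z : z \in a :: o -> z \in X by move=> zo; rewrite inE o1 ?o2'.
have XO z : z \in X -> z \in O by case/setIP => + _; exact: (subsetP XO1).
have : 3 < #|darts X (~: X)|.
  apply: brace_cut => //.
    case: o o2 oX ua {ca oO side o1 o2'} => [|h o] //= _ oX /andP[ah _].
    apply: (@leq_trans #|[set a; h]|); last first.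
      apply/subset_leq_card/subsetP => z; rewrite in_set2.
      by case/orP => /eqP->; apply: oX; rewrite !inE eqxx ?orbT.
    by rewrite cards2; move: ah; rewrite inE negb_or => /andP[->].
  apply: (@leq_trans #|[set v; b]|); last first.
    apply/subset_leq_card/subsetP => z zvb; rewrite inE; apply/negP => /XO.
    by move: zvb; rewrite !inE => /orP[]->; rewrite ?orbT.
  have [_ /adj_neq vb _ _] := n3; by rewrite cards2 vb.
apply/negP; rewrite -leqNgt.
pose D1 := darts X1 ((O :|: [set z in p]) :\: X1).
pose D2 := darts X2 ((O :|: [set z in q]) :\: X2).
apply: (@leq_trans #|[set (a, v)] :|: (D1 :|: D2)|).
  apply/subset_leq_card/subsetP => d dX.
  have dP := ring_boundary n3 rpq (_ : X \subset O) dX.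
  have {dP} := dP (introT subsetP XO).
  case: d dX => x y; rewrite in_darts => /and3P[xX yX xy] dP.
  have /setIP[xX1 xX2] := xX.
  rewrite !in_setU !in_darts xX1 xX2 xy !andbT /= !in_setD !in_setU.
  case: dP => [->|/=|/= yp|/= yq]; first by rewrite set11.
  - rewrite in_setD => /andP[_ yO]; rewrite [y \in O]yO.
    by move: yX; rewrite !in_setC in_setI negb_and => /orP[]->; rewrite ?orbT.
  - have -> : y \notin X1; last by rewrite inE yp !orbT.
    apply/negP => /(subsetP XO1); by rewrite !inE mem_cat yp !orbT.
  have -> : y \notin X2; last by rewrite [y \in [set z in q]]inE yq !orbT.
  apply/negP => /(subsetP XO2); by rewrite !inE mem_cat yq !orbT.
apply: leq_trans (leq_card_setU _ _) _; rewrite cards1 ltnS.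
by apply: leq_trans (leq_card_setU _ _) _; apply: (leq_add le1 le2).
Qed.

(** * Theta graphs *)

(** Three internally disjoint paths from [u] to [w] through [a], [b] and [c]
    respectively, each given by the two walks into which [a], [b] or [c] splits
    it: [pa] leads from [a] to [u] and [qa] from [a] to [w]. *)
Definition theta u w a pa qa b pb qb c pc qc :=
  [/\ walk a pa u /\ walk a qa w, walk b pb u /\ walk b qb w,
      walk c pc u /\ walk c qc w
    & uniq (v :: u :: w :: a :: b :: c :: pa ++ qa ++ pb ++ qb ++ pc ++ qc)].

(** An ear from [a] to both arcs of a ring exists, since a set provided by
    [ear_or_cut] instead would have at most two edges leaving it; its ends lie
    on different arcs by [ring_ear_false], and these together with the ear form
    the theta graph. *)
Lemma theta_exists a b c : nbrs3 a b c -> exists u w pa qa pb qb pc qc,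
  theta u w a pa qa b pb qb c pc qc.
Proof.
move=> n3; have [p [q rpq]] := ring_exists n3.
have [va vb vc u3] := n3.
have [wp wq u] := rpq; set O := outside b c p q.
have theta_of_ear x r y : x \in p -> y \in q -> ear O [set z in p ++ q] a x r y ->
    exists u w pa qa pb qb pc qc, theta u w a pa qa b pb qb c pc qc.
  move=> /mem_split[p1 [p2 eqp]] /mem_split[q1 [q2 eqq]] [wr [_ _ ar] rO ur].
  have [r1 [r2 eqr]] := mem_split ar.
  move: wp wq wr; rewrite eqp eqq eqr !walk_cat.
  move=> /andP[wp1 wp2] /andP[wq1 wq2] /andP[wr1 wr2].
  exists x, y, (rev r1), r2, p1, q1, (rev p2), (rev q2).
  split; rewrite -?walk_rev //.
  have disr : {in r, forall z, z \notin v :: b :: c :: p ++ q} by move=> z /rO; rewrite inE.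
  apply/uniq_countP => z; have := notin_count disr z; move/uniq_countP/(_ z): ur.
  by move/uniq_countP/(_ z): u; rewrite eqp eqq eqr; count_lia.
case: (boolP (a \in p ++ q)) => apq.
  have := @nbrs3_no_cycle a b c (b :: p ++ c :: rev q) n3; case.
  - by apply: walk_cycle; rewrite // -walk_rev.
  - by uniq_by_count u.
  - by move: apq; rewrite !(inE, mem_cat) mem_rev => /orP[]->; rewrite !orbT.
  - exact: mem_head.
  - by rewrite !(inE, mem_cat) eqxx !orbT.
have aO : a \in O.
  rewrite inE !in_cons !negb_or apq andbT eq_sym (adj_neq va) /=.
  by move: u3; rewrite /= !inE negb_or andbT => /andP[].
have vO : v \notin O :|: [set z in p ++ q].
  by rewrite !inE eqxx /=; case/andP: u; rewrite !in_cons => /norP[_ /norP[]].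
have dis : [disjoint O & [set z in p ++ q]].
  rewrite -setI_eq0; apply/eqP/setP => z; rewrite !inE.
  by case: (z \in p ++ q); rewrite ?andbF // !orbT.
have [x|[x [r [y e]]]|[X [aX XO le1]]] := ear_or_cut cubicG dis aO vO.
- rewrite inE mem_cat => /orP[] xpq; first exact: ring_inner rpq xpq.
  rewrite /O -outside_swap; exact: ring_inner (ring_swap rpq) xpq.
- have [wr [] + + ar rO ur] := e; rewrite !inE !mem_cat => xpq ypq.
  have earP (p' : seq G) : x \in p' -> y \in p' -> ear O [set z in p'] a x r y.
    by split=> //; rewrite !inE.
  case/orP: xpq ypq => xs /orP[]ys.
  + by case: (ring_ear_false n3 rpq (earP _ xs ys)).
  + exact: theta_of_ear xs ys e.
  + exact: theta_of_ear ys xs (ear_rev e).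
  by case: (@ring_ear_false a b c q p x r y n3 (ring_swap rpq)); rewrite outside_swap; apply: earP.
have : 2 < #|darts X (~: X)|.
  apply: (@brace_cut_ge3 _ cubicG braceG X a v) => //.
  by apply/negP => /(subsetP XO); rewrite !inE eqxx.
rewrite ltnNge => /negP[].
apply: (@leq_trans #|[set (a, v)] :|: darts X ((O :|: [set z in p ++ q]) :\: X)|); last first.
  by apply: leq_trans (leq_card_setU _ _) _; rewrite cards1 ltnS.
apply/subset_leq_card/subsetP => d dX; have dP := ring_boundary n3 rpq XO dX.
case: d dX dP => x y; rewrite in_darts in_setC => /and3P[xX yX xy] dP.
rewrite in_setU in_darts xX xy andbT in_setD yX in_setU in_set mem_cat /=.
case: dP => [->|/=|/= yp|/= yq]; rewrite ?set11 //.
- by case/setDP => ->; rewrite orbT.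
- by rewrite yp !orbT.
by rewrite yq !orbT.
Qed.

Lemma theta_rot u w a pa qa b pb qb c pc qc :
  theta u w a pa qa b pb qb c pc qc -> theta u w b pb qb c pc qc a pa qa.
Proof. by case=> ? ? ? uT; split=> //; uniq_by_count uT. Qed.

Lemma theta_flip u w a pa qa b pb qb c pc qc :
  theta u w a pa qa b pb qb c pc qc -> theta u w a pa qa c pc qc b pb qb.
Proof. by case=> ? ? ? uT; split=> //; uniq_by_count uT. Qed.

Lemma theta_swap u w a pa qa b pb qb c pc qc :
  theta u w a pa qa b pb qb c pc qc -> theta w u a qa pa b qb pb c qc pc.
Proof. by case=> -[? ?] [? ?] [? ?] uT; split=> //; uniq_by_count uT. Qed.

Lemma theta_ring u w a pa qa b pb qb c pc qc :
  theta u w a pa qa b pb qb c pc qc -> ring b c (pb ++ u :: rev pc) (qb ++ w :: rev qc).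
Proof.
case=> _ [bu bw] [cu cw] uT; split; rewrite ?walk_cat ?bu ?bw -?walk_rev //.
uniq_by_count uT.
Qed.

Definition theta_seq u w a pa qa b pb qb c pc qc :=
  v :: u :: w :: a :: b :: c :: pa ++ qa ++ pb ++ qb ++ pc ++ qc.

(** The theta graph uses all three edges at [u]. *)
Lemma theta_branch u w a pa qa b pb qb c pc qc z :
  theta u w a pa qa b pb qb c pc qc -> adj u z -> z \in a :: b :: c :: pa ++ pb ++ pc.
Proof.
case=> -[au _] [bu _] [cu _] uT uz.
have adj_last x s y : walk x s y -> adj y (last x s).
  by rewrite /walk rcons_path adj_sym => /andP[].
have count_last x s z' : z' == last x s -> 0 < (x == z') + count_mem z' s.
  by move/eqP->; have := mem_last x s; rewrite -has_pred1 has_count.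
have u3 : uniq [:: last a pa; last b pb; last c pc].
  rewrite /= !inE negb_or andbT.
  apply/andP; split; first apply/andP; first split; apply/negP.
  - move=> /eqP e; move/uniq_countP/(_ (last a pa)): uT.
    have := count_last a pa _ (eqxx _); have := count_last b pb _ (introT eqP e).
    by count_lia.
  - move=> /eqP e; move/uniq_countP/(_ (last a pa)): uT.
    have := count_last a pa _ (eqxx _); have := count_last c pc _ (introT eqP e).
    by count_lia.
  move=> /eqP e; move/uniq_countP/(_ (last b pb)): uT.
  have := count_last b pb _ (eqxx _); have := count_last c pc _ (introT eqP e).
  by count_lia.
have := cubic_nbr cubicG u3 (adj_last _ _ _ au) (adj_last _ _ _ bu) (adj_last _ _ _ cu) uz.
have in_last x s t : {subset x :: s <= t} -> last x s \in t by move/(_ _ (mem_last x s)).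
rewrite !inE => /or3P[]/eqP->; rewrite -?in_cons; apply: in_last => y;
  by rewrite !(inE, mem_cat) => /orP[]->; rewrite ?orbT.
Qed.

(** The cycle follows the arc of [a] to [w], the arc of [c] back to [u], the arc
    of [b] from [u] past [b] to [y], and the linking walk to [x], which lies
    between [u] and [a]. *)
Lemma theta_cross_false u w a pa qa b pb qb c pc qc x j y :
    nbrs3 a b c -> theta u w a pa qa b pb qb c pc qc -> x \in pa -> y \in qb ->
    walk x j y -> uniq j ->
    {in j, forall z, z \notin theta_seq u w a pa qa b pb qb c pc qc} -> False.
Proof.
move=> n3 [[au aw] [bu bw] [cu cw] uT] /mem_split[pa1 [pa2 eqa]] /mem_split[qb1 [qb2 eqb]].
move=> wj uj /notin_count dj.
move: au bw; rewrite eqa eqb !walk_cat => /andP[ax _] /andP[by_ _].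
apply: (@nbrs3_no_cycle a b c
  (a :: qa ++ w :: rev qc ++ c :: pc ++ u :: rev pb ++ b :: qb1 ++ y :: rev j ++ x :: rev pa1) n3).
- by rewrite cycle_walk !walk_cat aw cu by_ -!walk_rev cw bu wj.
- apply/uniq_countP => z; move/uniq_countP/(_ z): uT (dj z); move/uniq_countP/(_ z): uj.
  by rewrite /theta_seq eqa eqb; count_lia.
- exact: mem_head.
- by rewrite !(inE, mem_cat) eqxx !orbT.
by rewrite !(inE, mem_cat) eqxx !orbT.
Qed.

(** The link closes a part of the arc of [a] to a cycle through [a], disjoint
    from the ring formed by the arcs of [b] and [c]. *)
Lemma theta_same_false u w a pa qa b pb qb c pc qc x j y :
    nbrs3 a b c -> theta u w a pa qa b pb qb c pc qc -> x \in pa -> y \in qa ->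
    walk x j y -> uniq j ->
    {in j, forall z, z \notin theta_seq u w a pa qa b pb qb c pc qc} -> False.
Proof.
move=> n3 th; have rth := theta_ring th.
case: th => -[au aw] _ _ uT /mem_split[pa1 [pa2 eqp]] /mem_split[qa1 [qa2 eqq]].
move=> wj uj /notin_count dj.
move: au aw; rewrite eqp eqq !walk_cat => /andP[ax _] /andP[ay _].
apply: (@ring_off_cycle_false a b c _ _ (pa1 ++ x :: j ++ y :: rev qa1) n3 rth).
- by rewrite cycle_walk !walk_cat ax wj -walk_rev.
- apply/uniq_countP => z; move/uniq_countP/(_ z): uT (dj z); move/uniq_countP/(_ z): uj.
  by rewrite /theta_seq eqp eqq; count_lia.
- by rewrite !size_cat /= size_cat /=; clear; lia.
move=> z; rewrite /outside in_set -!has_pred1 !has_count -leqNgt.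
move/uniq_countP/(_ z): uT (dj z); rewrite /theta_seq eqp eqq; count_lia.
Qed.

Lemma nbrs3_flip a b c : nbrs3 a b c -> nbrs3 a c b.
Proof. by case=> va vb vc u; split=> //; uniq_by_count u. Qed.

Lemma theta_link_false u w a pa qa b pb qb c pc qc x j y :
    nbrs3 a b c -> theta u w a pa qa b pb qb c pc qc ->
    x \in pa -> y \in qa ++ qb ++ qc -> walk x j y -> uniq j ->
    {in j, forall z, z \notin theta_seq u w a pa qa b pb qb c pc qc} -> False.
Proof.
move=> n3 th xa + wj uj nT; rewrite !mem_cat => /or3P[] yq.
- exact: theta_same_false n3 th xa yq wj uj nT.
- exact: theta_cross_false n3 th xa yq wj uj nT.
apply: theta_cross_false (nbrs3_flip n3) (theta_flip th) xa yq wj uj _.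
by move=> z /nT; rewrite -!has_pred1 !has_count /theta_seq; count_lia.
Qed.

Lemma connect_link (e : rel G) (S S' : {set G}) x y :
    connect e x y -> x \in S -> y \in S' -> [disjoint S & S'] ->
  exists x' j y', [/\ path e x' (rcons j y'), uniq j, x' \in S, y' \in S'
                    & {in j, forall z, z \notin S :|: S'}].
Proof.
case/connectP => _ /shortenP[s xs us _] -> xS lS dis.
have [s1 [x' [s2 [eq1 xS' in2]]]] : exists s1 x' s2,
    [/\ x :: s = s1 ++ x' :: s2, x' \in S & {in s2, forall z, z \notin S}].
  by apply: (@split_last _ (mem S)); apply/hasP; exists x; rewrite ?mem_head.
have ls : last x s \in s2.
  have : last x s = last x' s2 by have := congr1 (last x) eq1; rewrite last_cat.
  case: (s2) => [/= l|z s3 /= ->]; last exact: mem_last.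
  by rewrite l (disjointFr dis xS') in lS.
have [j [y' [s3 [eq2 yS' inj]]]] : exists j y' s3,
    [/\ s2 = j ++ y' :: s3, y' \in S' & {in j, forall z, z \notin S'}].
  by apply: (@split_first _ (mem S')); apply/hasP; exists (last x s).
exists x', j, y'; split=> //.
- have : path e x' s2.
    case: s1 eq1 => [[<- <-]//|x1 s1 [eqx eqs]].
    by move: xs; rewrite eqs cat_path => /and3P[].
  by rewrite eq2 -cat_rcons cat_path => /andP[].
- move: us; rewrite eq1 eq2 cat_uniq /= cat_uniq.
  by case/and3P => _ _ /andP[_ /and3P[]].
move=> z zj; rewrite inE negb_or inj // andbT; apply: in2.
by rewrite eq2 mem_cat zj.
Qed.

(** A path from [u] to [w] contains a link between the two claws whose inner
    vertices are not on the theta graph.  Its ends are not [u] or [w], since all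
    edges at these belong to the theta graph. *)
Lemma theta_separates u w a pa qa b pb qb c pc qc :
    nbrs3 a b c -> theta u w a pa qa b pb qb c pc qc ->
  ~~ connect [rel x y | adj x y && (y \notin [:: v; a; b; c])] u w.
Proof.
move=> n3 th; apply/negP => uw.
have [_ _ _ uT] := th.
pose S := [set z in u :: pa ++ pb ++ pc]; pose S' := [set z in w :: qa ++ qb ++ qc].
have dis : [disjoint S & S'].
  rewrite -setI_eq0; apply/eqP/setP => z; rewrite in_setI in_set0 !in_set; apply/negP.
  rewrite -!has_pred1 !has_count => /andP[].
  by move/uniq_countP/(_ z): uT; count_lia.
have uS : u \in S by rewrite inE mem_head.
have wS' : w \in S' by rewrite inE mem_head.
have [x [j [y [xjy uj xS yS' jSS]]]] := connect_link uw uS wS' dis.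
have wj : walk x j y by move: xjy; apply: sub_path => z z' /andP[].
have jout : {in j, forall z, z \notin [:: v; a; b; c]}.
  move=> z zj; case/mem_split: (zj) => j1 [j2 eqj].
  move: xjy; rewrite eqj rcons_cat cat_path /= => /andP[_ /andP[/andP[_ +] _]].
  by [].
have nT : {in j, forall z, z \notin theta_seq u w a pa qa b pb qb c pc qc}.
  move=> z zj; move: (jout z zj) (jSS z zj).
  rewrite in_setU !in_set negb_or -!has_pred1 !has_count -!leqNgt => + /andP[].
  by rewrite /theta_seq; count_lia.
have xu : x != u.
  apply/negP => /eqP xu; rewrite xu in wj.
  case: (j) wj nT => [|z j'] wj' nT'.
    have uy : adj u y by move: wj'; rewrite /walk /= andbT.
    have := theta_branch th uy.
    move: yS'; rewrite in_set -!has_pred1 !has_count.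
    by move/uniq_countP/(_ y): uT; count_lia.
  have uz : adj u z by case/andP: wj'.
  have := theta_branch th uz; move: (nT' z (mem_head _ _)).
  by rewrite -!has_pred1 !has_count; rewrite /theta_seq; count_lia.
have yw : y != w.
  rewrite walk_rev in wj; apply/negP => /eqP yw; rewrite yw in wj.
  have nTr : {in rev j, forall z, z \notin theta_seq u w a pa qa b pb qb c pc qc}.
    by move=> z; rewrite mem_rev => /nT.
  case: (rev j) wj nTr => [|z j'] wj' nT'.
    have wx : adj w x by move: wj'; rewrite /walk /= andbT.
    have := theta_branch (theta_swap th) wx.
    move: xS; rewrite in_set -!has_pred1 !has_count.
    by move/uniq_countP/(_ x): uT; count_lia.
  have wz : adj w z by case/andP: wj'.
  have := theta_branch (theta_swap th) wz; move: (nT' z (mem_head _ _)).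
  by rewrite -!has_pred1 !has_count; rewrite /theta_seq; count_lia.
move: xS yS'; rewrite !in_set !in_cons (negPf xu) (negPf yw) /= => xS yS'.
move: xS; rewrite !mem_cat => /or3P[] xs.
- exact: theta_link_false n3 th xs yS' wj uj nT.
- apply: theta_link_false (nbrs3_rot n3) (theta_rot th) xs _ wj uj _.
    by move: yS'; rewrite !mem_cat => /or3P[]->; rewrite ?orbT.
  by move=> z /nT; rewrite -!has_pred1 !has_count /theta_seq; count_lia.
apply: theta_link_false (nbrs3_rot (nbrs3_rot n3)) (theta_rot (theta_rot th)) xs _ wj uj _.
  by move: yS'; rewrite !mem_cat => /or3P[]->; rewrite ?orbT.
by move=> z /nT; rewrite -!has_pred1 !has_count /theta_seq; count_lia.
Qed.

(** At most six edges lead from [a], [b] and [c] to vertices other than [v], so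
    one of the two sides receives at most three of them.  By [brace_cut] this
    side is a single vertex and receives exactly three, which leaves at most
    three for the other side. *)
Lemma theta_sides a b c u w : nbrs3 a b c ->
    u \notin [:: v; a; b; c] -> w \notin [:: v; a; b; c] ->
    ~~ connect [rel x y | adj x y && (y \notin [:: v; a; b; c])] u w ->
  [/\ forall x, adj u x -> adj v x, forall x, adj w x -> adj v x
    & forall x, x \in [:: v; u; w; a; b; c]].
Proof.
move=> n3 uabc wabc; set e := [rel x y | _] => nuw.
have [va vb vc u3] := n3.
pose K := [set z in [:: a; b; c]]; pose U := [set x | connect e u x].
pose W := ~: (v |: K :|: U).
have KE x : (x \in K) = adj v x.
  apply/idP/idP; first by rewrite !inE => /or3P[]/eqP->.
  by rewrite in_set => /(nbrs3_mem n3).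
have vabc x : (x \in [:: v; a; b; c]) = (x \in v |: K) by rewrite !inE.
have U_out x : x \in U -> x \notin v |: K.
  rewrite in_set -vabc => /connectP[p]; case/lastP: p => [_ ->//|p y].
  by rewrite rcons_path last_rcons => /andP[_ /andP[_ +]] ->.
have W_out x : x \in W -> x \notin v |: K by rewrite inE in_setU negb_or => /andP[].
have uU : u \in U by rewrite inE connect0.
have wW : w \in W by rewrite inE in_setU negb_or -vabc wabc inE.
have step x y : x \in U -> adj x y -> y \notin v |: K -> y \in U.
  rewrite -vabc !in_set => ux xy yn; apply: connect_trans ux _; apply: connect1.
  by rewrite /= xy.
have side (Z : {set G}) z : z \in Z -> (forall x, x \in Z -> x \notin v |: K) ->
    (forall x y, x \in Z -> y \notin Z -> adj x y -> y \in v |: K) ->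
    #|darts Z K| <= 3 -> [/\ Z = [set z], #|darts Z K| = 3 & forall x, adj z x -> adj v x].
  move=> zZ Zout Zbd le3.
  have sub : darts Z (~: Z) \subset darts Z K.
    apply/subsetP => -[x y]; rewrite !in_darts in_setC => /and3P[xZ yZ xy].
    rewrite xZ xy andbT; have := Zbd x y xZ yZ xy; rewrite in_setU1 => /predU1P[yv|//].
    have := Zout x xZ; by rewrite in_setU1 KE -yv adj_sym xy orbT.
  have Z1 : Z = [set z].
    apply/esym/eqP; rewrite eqEcard sub1set zZ cards1 leqNgt; apply/negP => Z2.
    have : 3 < #|darts Z (~: Z)|.
      apply: (brace_cut cubicG braceG Z2).
      apply: (@leq_trans #|[set v; a]|); first by rewrite cards2 (adj_neq va).
      apply/subset_leq_card/subsetP => x; rewrite in_set2 in_setC => xva.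
      apply/negP => /Zout/negP[]; rewrite in_setU1 KE.
      by case/orP: xva => /eqP->; rewrite ?eqxx // va orbT.
    by rewrite ltnNge (leq_trans (subset_leq_card sub)).
  split=> //.
    apply/eqP; rewrite eqn_leq le3 /=; apply: leq_trans (subset_leq_card sub).
    by rewrite Z1 (card_darts1 cubicG).
  move=> x zx; rewrite -KE; have: (z, x) \in darts Z K; last by rewrite in_darts => /and3P[].
  apply: (subsetP sub); rewrite in_darts in_setC zZ zx andbT Z1 inE.
  by rewrite eq_sym (adj_neq zx).
have disUW : [disjoint U & W].
  rewrite -setI_eq0; apply/eqP/setP => x; rewrite !in_setI in_setC in_setU in_set0.
  by case: (x \in U); rewrite // orbT.
have U_bd x y : x \in U -> y \notin U -> adj x y -> y \in v |: K.
  by move=> xU yU xy; apply: contraR yU; apply: step xy.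
have W_bd x y : x \in W -> y \notin W -> adj x y -> y \in v |: K.
  move=> xW; rewrite in_setC negbK in_setU => /orP[//|yU] xy.
  rewrite adj_sym in xy; have := step _ _ yU xy (W_out _ xW).
  by rewrite (disjointFl disUW xW).
have total : #|darts U K| + #|darts W K| <= 6.
  have : #|darts K [set v]| + (#|darts K U| + #|darts K W|) <= 9.
    rewrite -!card_dartsUr //.
      apply: leq_trans (dartsS (subxx K) (subsetT _)) _.
      rewrite (card_darts_out cubicG); apply: (@leq_mul 3 _ 3 3) => //.
      by rewrite cardsE; exact: card_size.
    rewrite -setI_eq0; apply/eqP/setP => x; rewrite in_setI in_set1 in_set0.
    case: (eqVneq x v) => //= ->; rewrite in_setU; apply/negP => /orP[/U_out|/W_out];
    by rewrite in_setU1 eqxx.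
  have : 3 <= #|darts K [set v]|.
    rewrite card_darts_sym -{1}(card_darts1 cubicG v); apply/subset_leq_card/subsetP => -[x y].
    by rewrite !in_darts in_set1 => /and3P[/eqP-> _ vy]; rewrite eqxx KE vy.
  by rewrite (card_darts_sym U) (card_darts_sym W); clear; lia.
have [sU sW] : #|darts U K| <= 3 /\ #|darts W K| <= 3.
  case: (leqP #|darts U K| 3) => U3; first split=> //.
    by have [_ d3 _] := side U u uU U_out U_bd U3; rewrite d3 in total.
  case: (leqP #|darts W K| 3) => W3.
    by have [_ d3 _] := side W w wW W_out W_bd W3; move: total U3; rewrite d3; clear; lia.
  by move: total U3 W3; clear; lia.
have [eU _ uK] := side U u uU U_out U_bd sU; have [eW _ wK] := side W w wW W_out W_bd sW.
split=> // x; have : x \in W \/ x \notin W by case: (x \in W); [left | right].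
rewrite {1}eW in_set1 => -[/eqP->|]; first by rewrite !in_cons eqxx !orbT.
rewrite in_setC negbK in_setU -vabc eU in_set1 !in_cons in_nil !orbF.
by case/orP => [/or4P[]|]->; rewrite ?orbT.
Qed.

End Ring.

(** * Perfect matchings in bipartite graphs *)

Section Bipartite.
Variables (G : sgraph) (f : G -> bool).
Hypothesis fP : forall x y, adj x y -> f x != f y.
Implicit Types (A : {set G}) (M : {set {set G}}).

Definition balanced A := #|A :&: [set x | f x]| = #|A :\: [set x | f x]|.

Lemma balancedC A : balanced setT -> balanced A -> balanced (~: A).
Proof.
rewrite /balanced => bT bA.
have := cardsID A [set x | f x]; have := cardsID A (~: [set x | f x]).
move: bT bA; rewrite !setDE !setTI !(setIC _ A) ![_ :&: ~: A]setIC.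
by clear; lia.
Qed.

(** Every edge of the matching has one end in each colour class. *)
Lemma perfect_matching_balanced A M : perfect_matching A M -> balanced A.
Proof.
case=> -[/subsetP Me trivM] <-.
have countM (P : pred G) : (forall x y, adj x y -> P x + P y = 1) ->
    #|[set x in cover M | P x]| = #|M|.
  move=> P1; rewrite -sum1_card (eq_bigl (fun x => (x \in cover M) && P x));
    last by move=> x; rewrite inE.
  rewrite big_mkcondr (big_trivIset _ trivM) /=.
  rewrite -sum1_card; apply: eq_bigr => B /Me /imset2P[x y _]; rewrite inE => /andP[_ xy] ->.
  rewrite big_setU1 ?inE ?(adj_neq xy) // big_set1; have := P1 _ _ xy.
  by case: (P x); case: (P y).
rewrite /balanced.
have -> : cover M :&: [set x | f x] = [set x in cover M | f x] by apply/setP => x; rewrite !inE.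
have -> : cover M :\: [set x | f x] = [set x in cover M | ~~ f x].
  by apply/setP => x; rewrite !inE andbC.
by rewrite !countM // => x y /fP; case: (f x); case: (f y).
Qed.

(** Passing to the next vertex on the cycle injects each colour class of the
    cycle into the other. *)
Lemma cycle_balanced s : ucycle (@adj G) s -> balanced [set x in s].
Proof.
case/andP => cs us.
have inj : injective (next s) by apply: can_inj (prev_next us).
have image_next (P Q : pred G) : (forall x y, adj x y -> P x -> Q y) ->
    #|[set x in s | P x]| <= #|[set x in s | Q x]|.
  move=> PQ; rewrite -(card_imset _ inj); apply/subset_leq_card/subsetP => _ /imsetP[x + ->].
  by rewrite !inE mem_next => /andP[xs Px]; rewrite xs (PQ x) // next_cycle.
rewrite /balanced.
have -> : [set x in s] :&: [set x | f x] = [set x in s | f x] by apply/setP => x; rewrite !inE.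
have -> : [set x in s] :\: [set x | f x] = [set x in s | ~~ f x].
  by apply/setP => x; rewrite !inE andbC.
by apply/eqP; rewrite eqn_leq !image_next // => x y /fP; case: (f x); case: (f y).
Qed.

Lemma cycle_even s : ucycle (@adj G) s -> ~~ odd (size s).
Proof.
move=> cs; have /andP[_ us] := cs; have := cycle_balanced cs; rewrite /balanced => bal.
have <- : #|[set x in s]| = size s by rewrite cardsE (card_uniqP us).
rewrite -(cardsID [set x | f x] [set x in s]) bal.
by rewrite addnn odd_double.
Qed.

End Bipartite.

Section Matchings.
Variable G : sgraph.
Implicit Types (A : {set G}) (M : {set {set G}}).

Lemma edgesP A B : reflect
  (exists x y, [/\ x \in A, y \in A, adj x y & B = [set x; y]]) (B \in edges A).
Proof.
apply: (iffP imset2P) => [[x y xA]|[x [y [xA yA xy ->]]]].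
  by rewrite inE => /andP[yA xy] ->; exists x, y.
by exists x y; rewrite ?inE ?yA.
Qed.

Lemma perfect_matchingU A1 A2 M1 M2 : [disjoint A1 & A2] ->
  perfect_matching A1 M1 -> perfect_matching A2 M2 ->
  perfect_matching (A1 :|: A2) (M1 :|: M2).
Proof.
move=> dis [[/subsetP e1 t1] c1] [[/subsetP e2 t2] c2]; split; last first.
  by rewrite /cover bigcup_setU -c1 -c2.
split.
  apply/subsetP => B; rewrite in_setU => /orP[/e1|/e2] /edgesP[x [y [xA yA xy ->]]];
  by apply/edgesP; exists x, y; rewrite !in_setU xA yA ?orbT.
have dis12 B1 B2 : B1 \in M1 -> B2 \in M2 -> [disjoint B1 & B2].
  move=> B1M B2M; apply: disjointWl (disjointWr _ dis); rewrite -?c1 -?c2 //;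
  exact: bigcup_sup.
apply/trivIsetP => B1 B2; rewrite !in_setU => /orP[]B1M /orP[]B2M neq.
- exact: (trivIsetP t1).
- exact: dis12.
- by rewrite disjoint_sym dis12.
exact: (trivIsetP t2).
Qed.

Lemma perfect_matching0 : perfect_matching (set0 : {set G}) set0.
Proof.
split; last by rewrite /cover big_set0.
by split; [apply: sub0set | apply/trivIsetP => B; rewrite inE].
Qed.

Lemma perfect_matching_edge (x y : G) : adj x y -> perfect_matching [set x; y] [set [set x; y]].
Proof.
move=> xy; split; last by rewrite /cover big_set1.
split; first by rewrite sub1set; apply/edgesP; exists x, y; rewrite !inE !eqxx orbT.
by apply/trivIsetP => B1 B2 /set1P-> /set1P->; rewrite eqxx.
Qed.

Lemma matching_cover M : matching [set: G] M -> perfect_matching (cover M) M.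
Proof.
case=> /subsetP eM tM; split=> //; split=> //; apply/subsetP => B BM.
have /edgesP[x [y [_ _ xy eqB]]] := eM B BM.
apply/edgesP; exists x, y; split=> //; apply/bigcupP; exists B => //;
  by rewrite eqB !inE eqxx ?orbT.
Qed.

Lemma conformal_isolated (v : G) s : conformal s -> v \notin s ->
  ~ (forall x, adj v x -> x \in s).
Proof.
case=> M [[/subsetP eM _] covM] vs vsub.
have : v \in cover M by rewrite covM !inE.
case/bigcupP => B /eM/edgesP[x [y [xA yA xy ->]]]; rewrite in_set2.
case/orP => /eqP vE; subst v.
  by move: yA; rewrite !inE vsub.
by move: xA; rewrite !inE vsub // adj_sym.
Qed.

End Matchings.

(** * The complete bipartite graph with three vertices in each class *)

Section K33.
Notation K := (complete_bipartite 3 3).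
Definition is_left (x : K) := if x is inl _ then true else false.

Lemma is_leftP (x y : K) : adj x y = (is_left x != is_left y).
Proof. by case: x y => ? []. Qed.

Lemma is_left_adj (x y : K) : adj x y -> is_left x != is_left y.
Proof. by rewrite is_leftP. Qed.

Lemma card_left : #|[set x : K | is_left x]| = 3.
Proof.
transitivity #|[set (inl i : K) | i in [set: 'I_3]]|; last first.
  by rewrite card_imset ?cardsT ?card_ord //; exact: inl_inj.
apply: eq_card => -[i|j]; rewrite [LHS]inE /=; first by rewrite imset_f.
by apply/esym/imsetP => -[].
Qed.

Lemma card_right : #|~: [set x : K | is_left x]| = 3.
Proof.
transitivity #|[set (inr j : K) | j in [set: 'I_3]]|; last first.
  by rewrite card_imset ?cardsT ?card_ord //; exact: inr_inj.
apply: eq_card => -[i|j]; rewrite [LHS]inE inE /=; last by rewrite imset_f.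
by apply/esym/imsetP => -[].
Qed.

Lemma K33_cubic : cubic K.
Proof.
move=> x; case: (boolP (is_left x)) => lx; [rewrite -[RHS]card_right | rewrite -[RHS]card_left];
by apply: eq_card => y; rewrite !inE is_leftP ?lx ?(negPf lx); case: (is_left y).
Qed.

Lemma K33_bipartite : bipartite K.
Proof. by exists is_left => x y; rewrite is_leftP. Qed.

Lemma K33_balanced_matching (A : {set K}) : balanced is_left A -> has_perfect_matching A.
Proof.
have [n] := ubnP #|A|; elim: n A => // n IHn A ltA bA.
case: (set_0Vmem (A :&: [set x | is_left x])) => [A0|[x xA]].
  exists set0; suff -> : A = set0 by apply: perfect_matching0.
  apply/eqP; rewrite -cards_eq0 -(cardsID [set x | is_left x] A) -bA A0 cards0.
  by [].
have : 0 < #|A :\: [set x | is_left x]| by rewrite -bA (cardsD1 x) xA.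
case/card_gt0P => y yA.
have xy : adj x y by rewrite is_leftP; move: xA yA; rewrite !inE => /andP[_ ->] /andP[/negPf->].
have [xA' yA'] : x \in A /\ y \in A by case/setIP: xA; case/setDP: yA.
have eqA : A = [set x; y] :|: (A :\: [set x; y]).
  by rewrite -[LHS](setID A [set x; y]) (setIidPr _) // subUset !sub1set xA'.
have [M pM] : has_perfect_matching (A :\: [set x; y]).
  apply: IHn.
    apply: leq_trans (ltA : #|A| <= n); apply: proper_card.
    apply/properP; split; first exact: subsetDl.
    by exists x; rewrite ?inE ?eqxx.
  have lx : is_left x by case/setIP: xA; rewrite inE.
  have ly : ~~ is_left y by case/setDP: yA; rewrite inE.
  move: bA; rewrite /balanced (cardsD1 x) xA [RHS](cardsD1 y) yA => -[].
  have -> : (A :&: [set x0 | is_left x0]) :\ x = (A :\: [set x; y]) :&: [set x0 | is_left x0].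
    apply/setP => z; rewrite !inE; case: (eqVneq z y) => [->|]; last by case: (z == x).
    by rewrite (negPf ly) !andbF.
  have -> // : (A :\: [set x0 | is_left x0]) :\ y = (A :\: [set x; y]) :\: [set x0 | is_left x0].
  apply/setP => z; rewrite !inE; case: (eqVneq z x) => [->|]; first by rewrite lx !andbF.
  by case: (z == y); rewrite /= ?andbF.
exists ([set [set x; y]] :|: M); rewrite eqA; apply: perfect_matchingU => //.
  by rewrite -setI_eq0 setIDA setDIl setDv set0I.
exact: perfect_matching_edge.
Qed.

Lemma K33_balanced : balanced is_left setT.
Proof. by rewrite /balanced setTI setTD card_left card_right. Qed.

Lemma K33_cycle_conformal : cycle_conformal K.
Proof.
split; first exact/K33_balanced_matching/K33_balanced.
move=> s [_ cs] _; apply: K33_balanced_matching; apply: balancedC; first exact: K33_balanced.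
exact: (cycle_balanced is_left_adj cs).
Qed.

Lemma K33_two_connected : two_connected K.
Proof.
have cardK : #|K| = 6 by rewrite -(cardsC [set x : K | is_left x]) card_left card_right.
split; first by rewrite cardK.
move=> X X1; have avoid (Y : {set K}) : #|Y| = 3 -> exists2 z, z \in Y & z \in ~: X.
  move=> Y3; have : 0 < #|Y :\: X|.
    have := cardsID X Y; have := subset_leq_card (subsetIr Y X); move: X1; rewrite Y3.
    by clear; lia.
  by case/card_gt0P => z /setDP[zY zX]; exists z; rewrite ?inE.
have [l] := avoid _ card_left; rewrite inE => ll lX.
have [r] := avoid _ card_right; rewrite !inE => rr rX.
split; first by apply/set0Pn; exists l.
have step (x y : K) : x \in ~: X -> y \in ~: X -> is_left x != is_left y ->
    connect [rel u v : K | [&& u \in ~: X, v \in ~: X & adj u v]] x y.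
  by move=> xX yX xy; apply: connect1; apply/and3P; rewrite is_leftP.
move=> x y xX yX; case: (boolP (is_left x != is_left y)) => [|]; first exact: step.
rewrite negbK => /eqP eqxy.
have [z zX xz] : exists2 z, z \in ~: X & is_left x != is_left z.
  case: (boolP (is_left x)) => lx; last by exists l; rewrite ?ll.
  by exists r; rewrite ?inE // (negPf rr).
by apply: (connect_trans (step x z xX zX xz)); apply: step; rewrite // -eqxy eq_sym.
Qed.

Lemma K33_brace : brace K.
Proof.
split; [exact: K33_two_connected | exact: K33_bipartite|].
move=> M mM _; have pM := matching_cover mM.
have [N pN] : has_perfect_matching (~: cover M).
  apply: K33_balanced_matching; apply: balancedC; first exact: K33_balanced.
  exact: (perfect_matching_balanced is_left_adj pM).
exists (M :|: N); last exact: subsetUl.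
rewrite -(setUCr (cover M)); apply: perfect_matchingU => //.
by rewrite -setI_eq0 setICr.
Qed.

(** In a cubic graph, three neighbours among the three vertices of [t] means all
    of them; counting degrees from [t] then rules out edges inside [t]. *)
Lemma isomorphic_K33 (G : sgraph) (s t : seq G) :
    cubic G -> size s = 3 -> size t = 3 -> uniq (s ++ t) -> (forall x, x \in s ++ t) ->
    {in s, forall x y, adj x y -> y \in t} -> isomorphic G K.
Proof.
move=> cubicG s3 t3 ust all st.
have /and3P[us _ ut] : [&& uniq s, ~~ has (mem s) t & uniq t] by rewrite -cat_uniq.
have dis x : x \in t -> x \notin s.
  by move: ust; rewrite cat_uniq => /and3P[_ /hasPn h _] /h.
have nbr (r : seq G) x : uniq r -> size r = 3 -> 
    ([set y | adj x y] \subset r) || ([set y in r] \subset [set y | adj x y]) ->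
    forall y, adj x y = (y \in r).
  move=> ur r3 sub y; have : [set y | adj x y] = [set y in r].
    have c3 : #|[set y in r]| = 3 by rewrite cardsE (card_uniqP ur).
    case/orP: sub => sub; [|apply/esym]; apply/eqP; rewrite eqEcard c3 cubicG leqnn andbT //.
    by apply/subsetP => z /(subsetP sub); rewrite inE.
  by move/setP/(_ y); rewrite !inE.
have adj_s x : x \in s -> forall y, adj x y = (y \in t).
  by move=> xs; apply: nbr => //; apply/orP; left; apply/subsetP => y; rewrite inE => /(st x xs).
have adj_t x : x \in t -> forall y, adj x y = (y \in s).
  move=> xt; apply: nbr => //; apply/orP; right; apply/subsetP => y; rewrite !inE => ys.
  by rewrite adj_sym adj_s.
have nt x : (x \in t) = (x \notin s).
  by apply/idP/idP => [/dis//|/negPf xs]; have := all x; rewrite mem_cat xs.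
pose g (x : G) : K := if x \in s then inl (inord (index x s)) else inr (inord (index x t)).
have g_left x : is_left (g x) = (x \in s) by rewrite /g; case: ifP.
exists g; last first.
  move=> x y; rewrite is_leftP !g_left; case: (boolP (x \in s)) => xs.
    by rewrite adj_s // nt; case: (y \in s).
  by rewrite adj_t ?nt //; case: (y \in s).
have inordK_index (r : seq G) x y : size r = 3 -> x \in r -> y \in r ->
    inord (index x r) = inord (index y r) :> 'I_3 -> x = y.
  move=> r3 xr yr /(congr1 val); rewrite /= !inordK -?r3 ?index_mem //.
  by move=> e; rewrite -(nth_index x xr) e nth_index.
apply: inj_card_bij.
  move=> x y; rewrite /g; case: ifP => xs; case: ifP => ys // [].
    exact: inordK_index.
  by apply: inordK_index; rewrite // nt ?xs ?ys.
rewrite -(cardsC [set x : K | is_left x]) card_left card_right.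
by rewrite -[3 + 3]/6 -[6]/(3 + 3) -{1}s3 -t3 -size_cat -(card_uniqP ust); apply: max_card.
Qed.

End K33.

(** * The characterisation *)

Theorem cubic_cycle_conformal_brace (G : sgraph) :
  cubic G -> cycle_conformal G -> brace G -> isomorphic G (complete_bipartite 3 3).
Proof.
move=> cubicG [_ confG] braceG; have [[G2 _] [f fP] _] := braceG.
have /card_gt0P[v _] := ltnW (ltnW G2).
have nadj x y : adj v x -> adj v y -> ~~ adj x y.
  move=> /fP vx /fP vy; apply/negP => /fP; move: vx vy.
  by case: (f v); case: (f x); case: (f y).
have noCycle s : cycle (@adj G) s -> uniq (v :: s) -> ~ (forall x, adj v x -> x \in s).
  move=> cs /= /andP[vs us] vsub.
  have ucs : ucycle (@adj G) s by rewrite /ucycle cs.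
  apply: (conformal_isolated _ vs vsub); apply: confG; last exact: (cycle_even fP ucs).
  split=> //; rewrite -(cubicG v) -(card_uniqP us); apply/subset_leq_card/subsetP => x.
  by rewrite inE => /vsub.
have [a [b [c n3]]] : exists a b c, nbrs3 v a b c.
  have := cubicG v; rewrite cardE.
  case: (enum _) (mem_enum [set y | adj v y]) (enum_uniq [set y | adj v y]) =>
    [|a [|b [|c [|]]]] //= mem u _.
  exists a, b, c; split=> //; [have := mem a|have := mem b|have := mem c];
  by rewrite !inE eqxx ?orbT => /esym.
have [u [w [pa [qa [pb [qb [pc [qc th]]]]]]]] := theta_exists cubicG braceG noCycle nadj n3.
have nuw := theta_separates cubicG braceG noCycle nadj n3 th.
have [_ _ _ uT] := th.
have [uK wK all] : [/\ forall x, adj u x -> adj v x, forall x, adj w x -> adj v x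
    & forall x, x \in [:: v; u; w; a; b; c]].
  apply: (theta_sides cubicG braceG n3 _ _ nuw).
    by rewrite -has_pred1 has_count -leqNgt; move/uniq_countP/(_ u): uT; rewrite /= eqxx; count_lia.
  by rewrite -has_pred1 has_count -leqNgt; move/uniq_countP/(_ w): uT; rewrite /= eqxx; count_lia.
apply: (@isomorphic_K33 G [:: v; u; w] [:: a; b; c]) => //.
  by uniq_by_count uT.
move=> x; rewrite !inE => /or3P[]/eqP-> y.
- exact: (nbrs3_mem cubicG n3).
- by move/uK; apply: (nbrs3_mem cubicG n3).
by move/wK; apply: (nbrs3_mem cubicG n3).
Qed.

Theorem theorem1p3 :
  [/\ cubic (complete_bipartite 3 3),
      cycle_conformal (complete_bipartite 3 3)
    & brace (complete_bipartite 3 3)] /\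
  (forall G : sgraph, cubic G -> cycle_conformal G -> brace G ->
     isomorphic G (complete_bipartite 3 3)).
Proof.
split; last exact: cubic_cycle_conformal_brace.
by split; [exact: K33_cubic | exact: K33_cycle_conformal | exact: K33_brace].
Qed.
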